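(* Let $q \in L^1_{\mathbb{R}}[0,\pi]$, $\alpha \in (0,\pi]$ and $\beta \in [0,\pi)$, and let $\mu_0(q,\alpha,\beta) < \mu_1(q,\alpha,\beta) < \dots < \mu_n(q,\alpha,\beta) < \dots$ be the eigenvalues, enumerated in increasing order, of the Sturm-Liouville problem $L(q,\alpha,\beta)$: $$-y'' + q(x)y = \mu y, \quad 0<x<\pi, \ \mu \in \mathbb{C},$$ $$y(0)\cos\alpha + y'(0)\sin\alpha = 0, \qquad y(\pi)\cos\beta + y'(\pi)\sin\beta = 0.$$ Then for every $n = 0,1,2,\dots$, the eigenfunctions of $L(q,\alpha,\beta)$ corresponding to the $n$-th eigenvalue $\mu_n(q,\alpha,\beta)$ have exactly $n$ zeros in $(0,\pi)$, and all these zeros are simple. If $\alpha = \pi$ and $\beta = 0$, then the $n$-th eigenfunction has $n+2$ zeros in $[0,\pi]$. If either $\alpha = \pi$ and $\beta \in (0,\pi)$, or $\beta = 0$ and $\alpha \in (0,\pi)$, then the $n$-th eigenfunction has $n+1$ zeros in $[0,\pi]$.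
   Context: $L^1_{\mathbb{R}}[0,\pi]$ denotes the set of real-valued summable (Lebesgue integrable) functions on $[0,\pi]$. Solutions of the differential equation are understood in the usual sense for summable coefficients: $y$ and $y'$ are absolutely continuous on $[0,\pi]$ and the equation holds almost everywhere. An eigenvalue of $L(q,\alpha,\beta)$ is a value of $\mu$ for which there is a nontrivial solution satisfying both boundary conditions; such a solution is an eigenfunction corresponding to $\mu$. It is well known that the eigenvalues of $L(q,\alpha,\beta)$ form a countable set and are real and simple (each eigenspace is one-dimensional), and that they can be enumerated in increasing order as $\mu_n(q,\alpha,\beta)$, $n=0,1,2,\dots$. The $n$-th eigenfunction is the eigenfunction corresponding to $\mu_n(q,\alpha,\beta)$, determined up to a nonzero constant factor. A zero $x_0$ of a solution $y$ is simple if $y(x_0)=0$ and $y'(x_0)\neq 0$. *)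

(* Defs.v *)
From HB Require Import structures.
From mathcomp Require Import all_boot all_order all_algebra.
From mathcomp Require Import complex.
From mathcomp Require Import all_classical all_reals all_analysis.

Set Implicit Arguments.
Unset Strict Implicit.
Unset Printing Implicit Defensive.

Import Order.TTheory GRing.Theory Num.Theory.
Import numFieldNormedType.Exports.

Local Open Scope classical_set_scope.
Local Open Scope ring_scope.
Local Open Scope complex_scope.

(* The library's [integrable] requires Borel measurability; allowing a change on
   a null set yields all Lebesgue-integrable functions. *)
Definition in_L1 (R : realType) (D : set R) (q : R -> R) : Prop :=
  exists2 p : R -> R, (@lebesgue_measure R).-integrable D (EFin \o p) &
    {ae @lebesgue_measure R, forall x : R, D x -> q x = p x}.

Definition abs_continuous (R : realType) (a b : R) (f : R -> R) : Prop :=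
  forall e : R, 0 < e -> exists2 d : R, 0 < d &
    forall (m : nat) (u v : 'I_m -> R),
      (forall i, a <= u i /\ u i <= v i /\ v i <= b) ->
      trivIset [set: 'I_m] (fun i => `]u i, v i[%classic) ->
      \sum_(i < m) (v i - u i) < d ->
      \sum_(i < m) `|f (v i) - f (u i)| < e.

(* Complex-valued functions of a real variable are treated componentwise. *)
Definition cabs_continuous (R : realType) (a b : R) (f : R -> R[i]) : Prop :=
  abs_continuous a b (fun x => complex.Re (f x)) /\
  abs_continuous a b (fun x => complex.Im (f x)).

(* The derivative relative to [D]: two-sided at interior points of an interval
   [D], one-sided at its endpoints; values of [f] outside [D] play no role. *)
Definition is_derive_within (R : realType) (D : set R) (f : R -> R) (x l : R)
    : Prop :=
  (f z - f x) / (z - x) @[z --> within D x^'] --> l.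

Definition is_cderive_within (R : realType) (D : set R) (f : R -> R[i])
    (x : R) (l : R[i]) : Prop :=
  is_derive_within D (fun z => complex.Re (f z)) x (complex.Re l) /\
  is_derive_within D (fun z => complex.Im (f z)) x (complex.Im l).

(* [y] solves -y'' + q y = mu y on (0, pi), with [dy] as y' on [0, pi]. *)
Definition SL_solution (R : realType) (q : R -> R) (mu : R[i])
    (y dy : R -> R[i]) : Prop :=
  [/\ cabs_continuous 0 pi y,
      cabs_continuous 0 pi dy,
      forall x, x \in `[0, pi] -> is_cderive_within `[0, pi] y x (dy x) &
      {ae @lebesgue_measure R, forall x : R, x \in `]0, pi[ ->
        exists2 ddy : R[i], is_cderive_within `[0, pi] dy x ddy &
          - ddy + (q x)%:C * y x = mu * y x}].

Definition SL_eigenfunction (R : realType) (q : R -> R) (alpha beta : R)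
    (mu : R[i]) (y : R -> R[i]) : Prop :=
  exists dy : R -> R[i],
    [/\ SL_solution q mu y dy,
        exists2 x, x \in `[0, pi] & y x != 0,
        y 0 * (cos alpha)%:C + dy 0 * (sin alpha)%:C = 0 &
        y pi * (cos beta)%:C + dy pi * (sin beta)%:C = 0].

Definition SL_eigenvalue (R : realType) (q : R -> R) (alpha beta : R)
    (mu : R[i]) : Prop :=
  exists y : R -> R[i], SL_eigenfunction q alpha beta mu y.

Definition zeros_in (R : realType) (D : set R) (y : R -> R[i]) : set R :=
  [set x | D x /\ y x = 0].

Definition simple_zero (R : realType) (y : R -> R[i]) (x : R) : Prop :=
  y x = 0 /\
  exists2 l : R[i], is_cderive_within `[0, pi] y x l & l != 0.

(* Main.v *)
Require Import Defs.
From HB Require Import structures.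
From mathcomp Require Import all_boot all_order all_algebra complex.
From mathcomp Require Import all_classical all_reals all_analysis.
From mathcomp Require Import ring lra.

(* With Q a primitive of q and the quasi-derivative u = y' - Q y, the equation
   becomes the system y' = Q y + u, u' = - (mu + Q^2) y - Q u, whose coefficients
   are continuous.  In Pruefer coordinates y = r sin t, u = r cos t it reduces to
   t' = (cos t + Q sin t)^2 + mu (sin t)^2, a Lipschitz scalar equation.  The
   angle t crosses each multiple of pi exactly once, upwards; t(pi) is continuous
   and strictly increasing in mu and becomes arbitrarily small as mu -> -oo.  The
   boundary condition at pi reads t(pi) = tb + k pi with tb in (0, pi], and k is
   then the number of zeros in (0, pi).  Hence the level k of the n-th eigenvalue
   is strictly increasing in n, and by the intermediate value theorem every lower
   level is attained by an eigenvalue, which forces k = n.  That an arbitrary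
   eigenfunction is a multiple of r sin t follows from Wronskians, using that an
   absolutely continuous function whose derivative vanishes a.e. is constant. *)

Import Order.TTheory GRing.Theory Num.Theory.
Import numFieldNormedType.Exports.

Local Open Scope classical_set_scope.
Local Open Scope ring_scope.
Local Open Scope complex_scope.
Local Open Scope card_scope.

(** * Calculus on an interval *)

Section calculus.
Context {R : realType}.
Implicit Types (f g : R -> R) (x a b : R).

Lemma derivD f g x a b : is_derive x 1 f a -> is_derive x 1 g b ->
  is_derive x 1 (fun z => f z + g z) (a + b).
Proof. exact: is_deriveD. Qed.

Lemma derivB f g x a b : is_derive x 1 f a -> is_derive x 1 g b ->
  is_derive x 1 (fun z => f z - g z) (a - b).
Proof. exact: is_deriveB. Qed.

Lemma derivM f g x a b : is_derive x 1 f a -> is_derive x 1 g b ->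
  is_derive x 1 (fun z => f z * g z) (f x * b + g x * a).
Proof. exact: is_deriveM. Qed.

Lemma deriv_cst x c : is_derive x 1 (fun _ : R => c : R) 0.
Proof. exact: is_derive_cst. Qed.

Lemma deriv_comp f g x a b : is_derive x 1 g a -> is_derive (g x) 1 f b ->
  is_derive x 1 (fun z => f (g z)) (b * a).
Proof. move=> ga fb; exact: is_derive1_comp. Qed.

Lemma deriv_scale x c : is_derive x 1 (fun z : R => c * z) c.
Proof.
apply: is_derive_eq (derivM _ _ _ _ _ (deriv_cst x c) (is_derive_id x 1)) _.
by ring.
Qed.

Lemma deriv_expR x c : is_derive x 1 (fun z => expR (c * z)) (expR (c * x) * c).
Proof. exact: deriv_comp (deriv_scale _ _) (is_derive_expR _). Qed.

Lemma deriv_cont f x a : is_derive x 1 f a -> {for x, continuous f}.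
Proof. by case=> + _; move/derivable1_diffP/differentiable_continuous. Qed.

Lemma cont_within f a b :
  (forall x, a <= x <= b -> {for x, continuous f}) ->
  {within `[a, b], continuous f}.
Proof.
move=> fc; apply: continuous_in_subspaceT => x; rewrite inE/= in_itv/= => xab.
exact: fc.
Qed.

Lemma MVT_closed {f} df {a b} :
  (forall x, a <= x <= b -> is_derive x 1 f (df x)) -> a <= b ->
  exists2 c, a <= c <= b & f b - f a = df c * (b - a).
Proof.
move=> fd ab.
have [||c] := @MVT_segment R (fun x => f x) df a b ab.
- by move=> x; rewrite in_itv/= => /andP[/ltW ax /ltW xb]; apply: fd; rewrite ax.
- by apply: cont_within => x /fd /deriv_cont.
by rewrite in_itv/=; exists c.
Qed.

Lemma deriv_nondecreasing {f} df {a b} :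
  (forall x, a <= x <= b -> is_derive x 1 f (df x)) ->
  (forall x, a < x < b -> 0 <= df x) -> a <= b -> f a <= f b.
Proof.
move=> fd df0; rewrite le_eqVlt => /predU1P[->//|ab].
have [||c] := @MVT R (fun x => f x) df a b ab.
- by move=> x; rewrite in_itv/= => /andP[/ltW ax /ltW xb]; apply: fd; rewrite ax.
- by apply: cont_within => x /fd /deriv_cont.
rewrite in_itv/= => cab fE.
by rewrite -subr_ge0 fE mulr_ge0 ?df0// subr_ge0 ltW.
Qed.

(* The integrating factor [expR (K * x)] absorbs the term [- K * `|g x|]. *)
Lemma gronwall_ge0 {g} dg K {a b} :
  (forall x, a <= x <= b -> is_derive x 1 g (dg x)) ->
  (forall x, a <= x <= b -> - K * `|g x| <= dg x) ->
  0 <= g a -> forall x, a <= x <= b -> 0 <= g x.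
Proof.
move=> gd dgK ga x /andP[ax xb]; rewrite leNgt; apply/negP => gx.
have gc : {within `[a, x], continuous g}.
  apply: cont_within => z /andP[az zx]; apply: deriv_cont (gd z _).
  by rewrite az (le_trans zx).
(* Let [s] be the last point of [[a, x]] at which [g] is nonnegative. Beyond it [g] is negative, so
   that [expR (- K * z) * g z] is nondecreasing on [[s, x]], against [g x < 0]. *)
pose A := [set z | a <= z <= x /\ 0 <= g z].
have A0 : A a by split; rewrite ?lexx.
have ubA : ubound A x by move=> z [/andP[]].
have supA : has_sup A by split; [exists a | exists x].
set s := sup A.
have as_ : a <= s by exact: (sup_upper_bound supA).
have sx : s <= x by by apply: ge_sup => //; exists a.
have gneg z : s < z -> z <= x -> g z < 0.
  move=> sz zx; rewrite ltNge; apply/negP => gz.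
  suff : z <= s by rewrite leNgt sz.
  apply: (sup_upper_bound supA); split => //.
  by rewrite zx andbT (le_trans as_ (ltW sz)).
have gs : 0 <= g s.
  rewrite leNgt; apply/negP => gs.
  have /(_ _)/deriv_cont/cvgr_lt/(_ _ gs) := gd s _.
  rewrite as_ (le_trans sx)// => /(_ isT) [e /= e0 He].
  have [z [/andP[az zx] gz] sez] := sup_adherent e0 supA.
  have zs : z <= s by apply: (sup_upper_bound supA); split => //; rewrite az.
  suff : g z < 0 by lra.
  by apply: He; rewrite /= ger0_norm ?subr_ge0// -/s in sez *; lra.
pose h z := expR (- K * z) * g z.
suff : h s <= h x.
  have := expR_gt0 (- K * s); have := expR_gt0 (- K * x); rewrite /h; nra.
apply: (@deriv_nondecreasing _ (fun z => expR (- K * z) * dg z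
  + g z * (expR (- K * z) * - K))) => //.
- move=> z /andP[sz zx]; apply: derivM (deriv_expR _ _) (gd _ _).
  by rewrite (le_trans as_)//= (le_trans zx).
- move=> z /andP[sz zx].
  have zab : a <= z <= b by rewrite (le_trans as_ (ltW sz))//= (le_trans (ltW zx)).
  have := dgK z zab; have := expR_gt0 (- K * z).
  have gz := gneg z sz (ltW zx); rewrite ltr0_norm//; nra.
Qed.

Lemma cont_bounded f a b : (forall x, a <= x <= b -> {for x, continuous f}) ->
  exists2 M, 0 <= M & forall x, a <= x <= b -> `|f x| <= M.
Proof.
move=> fc; have [ab|ba] := leP a b; last first.
  by exists 0 => // x /andP[ax xb]; have := le_trans ax xb; rewrite leNgt ba.
have [c _ Hc] := EVT_max ab (cont_within f a b fc).
have [d _ Hd] := EVT_min ab (cont_within f a b fc).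
exists (`|f c| + `|f d|) => [|x xab]; first by rewrite addr_ge0.
have := Hc x; have := Hd x; rewrite in_itv/= xab => /(_ isT) h1 /(_ isT) h2.
have := ler_norm (f c); have := ler_norm (- f d); rewrite normrN => h3 h4.
by rewrite ler_norml; have := normr_ge0 (f c); have := normr_ge0 (f d); lra.
Qed.

(** Projection of the line onto [[0, T]]: composing with it extends a function from [[0, T]] by
    constants, which makes continuity two-sided at 0 and [T]. *)
Definition clamp (T x : R) : R := Num.min (Num.max x 0) T.

Lemma clamp_itv T x : 0 <= T -> 0 <= clamp T x <= T.
Proof. by move=> T0; rewrite /clamp ge_min lexx orbT le_min T0 le_max lexx
  orbT. Qed.

Lemma clamp_id T x : 0 <= x <= T -> clamp T x = x.
Proof. by move=> /andP[x0 xT]; rewrite /clamp max_l// min_l. Qed.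

Lemma clamp_continuous T : continuous (clamp T).
Proof.
move=> x; apply: (@continuous_min R R (fun z => Num.max z 0) (fun=> T)).
  apply: (@continuous_max R R id (fun=> 0)); first exact: cvg_id.
  exact: cst_continuous.
exact: cst_continuous.
Qed.

Lemma primitive_exists T g : 0 <= T ->
  (forall x, 0 <= x <= T -> {for x, continuous g}) ->
  exists2 G, G 0 = 0 & forall x, 0 <= x <= T -> is_derive x 1 G (g x).
Proof.
move=> T0 gc; pose h := g \o clamp T.
have hc : continuous h.
  move=> x; apply: continuous_comp; first exact: clamp_continuous.
  exact/gc/clamp_itv.
(* Integrating the extension from -1 makes 0 and [T] interior points of the domain, so that the
   primitive is differentiable there on both sides. *)
pose F x := \int[lebesgue_measure]_(t in `[(-1), x]) h t.
have hi : (@lebesgue_measure R).-integrable `[(-1), (T + 1)] (EFin \o h).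
  apply: continuous_compact_integrable; first exact: segment_compact.
  exact: continuous_subspaceT.
exists (fun x => F x - F 0) => [|x /andP[x0 xT]]; first by rewrite subrr.
have [||dF F'] := @continuous_FTC1_closed R h (-1) x (T + 1) _ hi _ (hc x).
- by lra.
- by lra.
have -> : g x = g x - 0 by rewrite subr0.
apply: derivB (deriv_cst _ _).
apply: DeriveDef => //.
by rewrite -derive1E F' /h /= clamp_id// x0.
Qed.

(** [C * expR (L * x)] minus or plus [D x] is nondecreasing in both cases. With [L = 2 * K] this
    turns a Lipschitz constant [K] into a contraction factor 1/2 for the sup norm weighted by
    [expR (- L * x)]. *)
Lemma expR_weight_bound (D dD : R -> R) T C L : 0 <= C -> D 0 = 0 ->
  (forall x, 0 <= x <= T -> is_derive x 1 D (dD x)) ->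
  (forall x, 0 <= x <= T -> `|dD x| <= C * (expR (L * x) * L)) ->
  forall x, 0 <= x <= T -> `|D x| <= C * expR (L * x).
Proof.
move=> C0 D0 Dd DL x /andP[x0 xT].
pose E z : R := C * expR (L * z).
have Ed (z : R) : is_derive z 1 E (C * (expR (L * z) * L)).
  apply: is_derive_eq (derivM _ _ _ _ _ (deriv_cst _ C) (deriv_expR z L)) _.
  by rewrite mulr0 addr0.
have zT z : 0 <= z <= x -> 0 <= z <= T.
  by move=> /andP[-> /= /le_trans]; apply.
have h1 : E 0 - D 0 <= E x - D x.
  apply: deriv_nondecreasing (fun z zx => derivB _ _ _ _ _ (Ed z) (Dd z (zT z
    zx))) _ x0.
  move=> z /andP[/ltW z0 /ltW zx]; have := DL z (zT z _).
  by rewrite z0 zx => /(_ isT); rewrite ler_norml; lra.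
have h2 : E 0 + D 0 <= E x + D x.
  apply: deriv_nondecreasing (fun z zx => derivD _ _ _ _ _ (Ed z) (Dd z (zT z
    zx))) _ x0.
  move=> z /andP[/ltW z0 /ltW zx]; have := DL z (zT z _).
  by rewrite z0 zx => /(_ isT); rewrite ler_norml; lra.
by move: h1 h2; rewrite /E D0 mulr0 expR0 ler_norml; lra.
Qed.

Lemma half_pow_small (a C : R) : (forall n, a <= C * 2^-1 ^+ n) -> a <= 0.
Proof.
move=> aC; rewrite leNgt; apply/negP => a0.
have C0 : 0 < C by have := aC 0; rewrite expr0 mulr1; lra.
have h : `|2^-1 : R| < 1 by rewrite ger0_norm//; lra.
have /cvgr_lt/(_ _ a0)[N _ /(_ N (leqnn N))] := cvg_geometric C h.
by rewrite /= ltNge aC.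
Qed.

(** The intervals of radius [2 * M * 2^-1 ^+ n] around [u n] are nested, the radius being the tail
    of the geometric series; the supremum of their left ends lies in all of them. *)
Lemma half_pow_limit (u : nat -> R) M :
  (forall n, `|u n.+1 - u n| <= M * 2^-1 ^+ n) ->
  exists l, forall n, `|l - u n| <= 2 * M * 2^-1 ^+ n.
Proof.
move=> uM; have wS n : (2^-1 : R) ^+ n.+1 = 2^-1 ^+ n / 2.
  by rewrite exprS mulrC.
pose lo n := u n - 2 * M * 2^-1 ^+ n; pose up n := u n + 2 * M * 2^-1 ^+ n.
have loS : {homo lo : m n / (m <= n)%N >-> m <= n}.
  apply: homo_leq => [x|y x z|n]; [exact: lexx|exact: le_trans|].
  by have := uM n; rewrite /lo wS ler_norml; lra.
have upS : {homo up : m n / (m <= n)%N >-> n <= m}.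
  apply: homo_leq => [x|y x z xy yz|n]; [exact: lexx|exact: le_trans yz xy|].
  by have := uM n; rewrite /up wS ler_norml; lra.
have loup m n : lo m <= up n.
  apply: le_trans (loS _ _ (leq_maxl m n)) _.
  apply: le_trans (upS _ _ (leq_maxr m n)).
  have := le_trans (normr_ge0 _) (uM (maxn m n)); rewrite /lo /up; lra.
have supl : has_sup (range lo).
  by split; [exists (lo 0); exists 0%N | exists (up 0) => _ [n _ <-]].
exists (sup (range lo)) => n.
have h1 : lo n <= sup (range lo) by apply: (sup_upper_bound supl); exists n.
have h2 : sup (range lo) <= up n.
  by apply: ge_sup; [exists (lo 0); exists 0%N | move=> _ [m _ <-]].
by move: h1 h2; rewrite /lo /up ler_norml; lra.
Qed.

Lemma uniform_approx_continuous f x :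
  (forall e, 0 < e -> exists2 k : R -> R, {for x, continuous k} &
    forall z, `|f z - k z| <= e) -> {for x, continuous f}.
Proof.
move=> fk; apply/cvgrPdist_lt => e e0.
have [|k kc kf] := fk (e / 3); first by lra.
have e3 : 0 < e / 3 by lra.
move/cvgrPdist_lt : kc => /(_ _ e3); apply: filterS => z.
have := kf x; have := kf z; rewrite !ler_norml !ltr_norml.
by move=> /andP[? ?] /andP[? ?] /andP[? ?]; apply/andP; split; lra.
Qed.

End calculus.

(** * Global solutions of Lipschitz scalar equations *)

Section ode.
Context {R : realType}.

(** Picard iteration in the sup norm weighted by [expR (- 2 * K * x)]: every step halves distances,
    whatever the length [T]. *)
Lemma ode_exists (F : R -> R -> R) (T K t0 : R) : 0 <= T -> 0 < K ->
  (forall x s t : R, 0 <= x <= T -> `|F x s - F x t| <= K * `|s - t|) ->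
  (forall (th : R -> R) (x : R), 0 <= x <= T -> {for x, continuous th} ->
    {for x, continuous (fun z => F z (th z))}) ->
  exists2 th : R -> R, th 0 = t0 &
    forall x : R, 0 <= x <= T -> is_derive x 1 th (F x (th x)).
Proof.
move=> T0 K0 FK Fc.
pose good (g : R -> R) := forall x : R, 0 <= x <= T -> {for x, continuous g}.
(* [I] is a total operator that integrates only functions continuous on [[0, T]]; hence the
   invariant [good]. *)
have /choice[I HI] : forall g, exists G : R -> R, good g ->
    G 0 = 0 /\ forall x : R, 0 <= x <= T -> is_derive x 1 G (g x).
  move=> g; have [gc|ngc] := pselect (good g); last by exists g.
  by have [G G0 Gd] := primitive_exists T g T0 gc; exists G.
pose step th x := t0 + I (fun z => F z (th z)) x.
have Fg th : good th -> good (fun z => F z (th z)) by move=> h x xT; exact/Fc/h.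
have stepd th : good th ->
    forall x : R, 0 <= x <= T -> is_derive x 1 (step th) (F x (th x)).
  move=> thg x xT; have [_ Id] := HI _ (Fg _ thg).
  by apply: is_derive_eq (derivD _ _ _ _ _ (deriv_cst _ _) (Id x xT)) _;
    rewrite add0r.
have step0 th : good th -> step th 0 = t0.
  by move=> thg; have [I0 _] := HI _ (Fg _ thg); rewrite /step I0 addr0.
pose it n := iter n step (fun=> t0).
have itg n : good (it n).
  elim: n => [x _|n IH x xT]; first exact: cst_continuous.
  exact: deriv_cont (stepd _ IH x xT).
have itd n := stepd _ (itg n).
pose L := 2 * K; pose E x := expR (L * x).
have L0 : 0 < L by rewrite /L; lra.
have [M M0 HM] : exists2 M, 0 <= M & forall x : R, 0 <= x <= T ->
  `|it 1 x - it 0 x| <= M.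
  apply: cont_bounded => x xT; apply: (@continuousB R R R); exact: itg.
have E1 x : 0 <= x <= T -> 1 <= E x.
  by move=> /andP[x0 _]; rewrite -expR0 ler_expR mulr_ge0// ltW.
have itM n x : 0 <= x <= T -> `|it n.+1 x - it n x| <= (M * 2^-1 ^+ n) * E x.
  elim: n x => [|n IH] x xT.
    rewrite expr0 mulr1; apply: le_trans (HM x xT) _.
    by rewrite ler_peMr// E1.
  apply: (expR_weight_bound _ _ _ _ _ _ _
    (fun z zT => derivB _ _ _ _ _ (itd n.+1 z zT) (itd n z zT))) xT.
  - by rewrite mulr_ge0.
  - by rewrite !step0// subrr.
  - move=> z zT; apply: le_trans (FK _ _ _ zT) _.
    apply: le_trans (ler_wpM2l (ltW K0) (IH z zT)) _.
    by rewrite le_eqVlt; apply/orP; left; apply/eqP; rewrite -/(E z) exprS /L;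
      field.
pose B := M * E T.
have EM x : 0 <= x <= T -> E x <= E T.
  by move=> /andP[_ xT]; rewrite ler_expR ler_pM2l.
have w0 n : 0 <= (2^-1 : R) ^+ n by rewrite exprn_ge0.
have B0 : 0 <= B by rewrite mulr_ge0// expR_ge0.
(* The limit is taken along the iterates at [clamp T x], which makes [h] continuous on both sides at
   0 and [T]. *)
have /choice[h hB] : forall x, exists l, forall n,
    `|l - it n (clamp T x)| <= 2 * B * 2^-1 ^+ n.
  move=> x; apply: half_pow_limit => n.
  apply: le_trans (itM n _ (clamp_itv _ x T0)) _.
  by rewrite mulrAC ler_wpM2r// ler_wpM2l// EM// clamp_itv.
have hB' n x : 0 <= x <= T -> `|h x - it n x| <= 2 * B * 2^-1 ^+ n.
  by move=> xT; rewrite -{2}(clamp_id T x xT).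
have hg : good h.
  move=> x xT; apply: uniform_approx_continuous => e e0.
  have half1 : `|2^-1 : R| < 1 by rewrite ger0_norm//; lra.
  have /cvgr_lt/(_ _ e0)[N _ /(_ N (leqnn N)) /= HN] := cvg_geometric (2 * B) half1.
  exists (it N \o clamp T) => [|z]; last by apply: le_trans (hB z N) (ltW HN).
  by apply: continuous_comp; [exact: clamp_continuous | exact/itg/clamp_itv].
(* The solution is [step h], a primitive and so differentiable on both sides at 0 and [T], whereas
   [h] is constant beyond them. The two agree on [[0, T]] because both are within a multiple of
   [2^-1 ^+ n] of [it n.+1]. *)
exists (step h); first exact: step0.
suff hE x : 0 <= x <= T -> step h x = h x.
  by move=> x xT; rewrite hE//; exact: stepd.
move=> xT; apply/eqP; rewrite -subr_eq0 -normr_le0.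
apply: (half_pow_small _ (2 * B + B * E T)) => n.
have wn := w0 n; have h1 := hB' n.+1 x xT.
have h2 : `|step h x - it n.+1 x| <= B * 2^-1 ^+ n * E x.
  apply: (expR_weight_bound _ _ _ _ _ _ _
    (fun z zT => derivB _ _ _ _ _ (stepd h hg z zT) (itd n z zT))) xT.
  - by rewrite mulr_ge0.
  - by rewrite !step0// subrr.
  - move=> z zT; apply: le_trans (FK _ _ _ zT) _.
    apply: le_trans (ler_wpM2l (ltW K0) (hB' n z zT)) _.
    rewrite (_ : K * _ = B * 2^-1 ^+ n * L); last by rewrite /L; ring.
    apply: ler_wpM2l; first by rewrite mulr_ge0.
    by have := E1 z zT; rewrite /E; nra.
have h3 : B * 2^-1 ^+ n * E x <= B * 2^-1 ^+ n * E T.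
  apply: ler_wpM2l; first by rewrite mulr_ge0. exact: EM.
have h4 := ler_distD (it n.+1 x) (step h x) (h x).
rewrite (distrC (it _ _) (h x)) in h4.
have h5 : 2 * B * 2^-1 ^+ n.+1 <= 2 * B * 2^-1 ^+ n.
  by rewrite exprS; have := mulr_ge0 B0 wn; lra.
lra.
Qed.

End ode.

(** * The Pruefer equation *)

Section trig.
Context {R : realType}.
Implicit Types (s t x : R).

Lemma sin_lipschitz s t : `|sin s - sin t| <= `|s - t|.
Proof.
wlog ts : s t / t <= s.
  by move=> H; have [/H//|/ltW/H] := leP t s; rewrite distrC (distrC t).
have [c _ ->] := MVT_closed cos (fun z _ => is_derive_sin z) ts.
by rewrite normrM ler_piMl// ler_norml cos_geN1 cos_le1.
Qed.

Lemma cos_lipschitz s t : `|cos s - cos t| <= `|s - t|.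
Proof. by rewrite -!sinDpihalf; apply: le_trans (sin_lipschitz _ _) _;
  rewrite opprD addrACA subrr addr0. Qed.

Lemma sin_natpi_eq0 x (j : nat) : (sin (x + j%:R * pi) == 0) = (sin x == 0).
Proof.
elim: j => [|j IH]; first by rewrite mul0r addr0.
by rewrite -natr1 mulrDl mul1r addrA sinDpi oppr_eq0.
Qed.

Lemma sin_natpi (j : nat) : sin (j%:R * pi : R) = 0.
Proof. by apply/eqP; rewrite -[_ * _]add0r sin_natpi_eq0 sin0. Qed.

Lemma sin_eq0_natpi x : 0 <= x -> sin x = 0 -> exists j : nat, x = j%:R * pi.
Proof.
move=> x0 sx; have p0 := pi_gt0 R.
have /truncn_itv/andP[] : 0 <= x / pi by rewrite divr_ge0// ltW.
set j := Num.truncn _; rewrite ler_pdivlMr// ltr_pdivrMr// -natr1 => h1 h2.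
exists j; apply/eqP; rewrite -subr_eq0; apply: contraT => h3.
have : 0 < sin (x - j%:R * pi).
  apply: sin_gt0_pi; rewrite lt_neqAle eq_sym h3 subr_ge0 h1/=; lra.
by rewrite lt_neqAle eq_sym -(sin_natpi_eq0 _ j) subrK sx eqxx.
Qed.

Lemma sin0_cos2 x : sin x = 0 -> cos x ^+ 2 = 1.
Proof. by move=> sx; have := cos2Dsin2 x; rewrite sx expr0n addr0. Qed.

End trig.

(** * The Pruefer angle and its levels *)

Section prufer.
Context {R : realType}.
Implicit Types (Q th : R -> R) (m s t x T K : R).

Definition prufer_rhs Q m x s : R :=
  (cos s + Q x * sin s) ^+ 2 + m * sin s ^+ 2.

Definition prufer_angle Q T m th :=
  forall x : R, 0 <= x <= T -> is_derive x 1 th (prufer_rhs Q m x (th x)).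

Lemma prufer_rhs_sin0 Q m x s : sin s = 0 -> prufer_rhs Q m x s = 1.
Proof. by move=> s0; rewrite /prufer_rhs s0 !mulr0 addr0 sin0_cos2// expr0n
  mulr0 addr0. Qed.

Lemma prufer_rhs_lipschitz Q T m : continuous Q ->
  exists2 K, 0 < K & forall x s t, 0 <= x <= T ->
    `|prufer_rhs Q m x s - prufer_rhs Q m x t| <= K * `|s - t|.
Proof.
move=> Qc; have [M M0 HM] := cont_bounded Q 0 T (fun x _ => Qc x).
(* The difference of squares splits into factors at most [(1 + M) * |s - t|] and [2 * (1 + M)]; the
   term with [m] adds [2 * |m| * |s - t|]. *)
exists (2 * (1 + M) ^+ 2 + 2 * `|m|) => [|x s t /HM QM].
  by have := normr_ge0 m; nra.
have abs1 y z : `|y| <= 1 -> `|z| <= 1 -> `|y + Q x * z| <= 1 + M.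
  move=> y1 z1; apply: le_trans (ler_normD _ _) _; rewrite lerD// normrM.
  by rewrite -[M]mulr1 ler_pM.
have s1 u : `|sin u : R| <= 1 by rewrite ler_norml sin_geN1 sin_le1.
have c1 u : `|cos u : R| <= 1 by rewrite ler_norml cos_geN1 cos_le1.
have -> : prufer_rhs Q m x s - prufer_rhs Q m x t =
  ((cos s - cos t) + Q x * (sin s - sin t)) *
  ((cos s + Q x * sin s) + (cos t + Q x * sin t)) +
  m * ((sin s - sin t) * (sin s + sin t)) by rewrite /prufer_rhs; ring.
apply: le_trans (ler_normD _ _) _; rewrite [leRHS]mulrDl lerD// !normrM.
  rewrite (_ : _ * `|s - t| = ((1 + M) * `|s - t|) * ((1 + M) + (1 + M)));
    last by ring.
  apply: ler_pM => //.
    apply: le_trans (ler_normD _ _) _; rewrite [leRHS]mulrDl mul1r lerD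
      ?cos_lipschitz//.
    by rewrite normrM ler_pM// sin_lipschitz.
  by apply: le_trans (ler_normD _ _) _; rewrite lerD// abs1.
rewrite (_ : 2 * `|m| * _ = `|m| * (`|s - t| * 2)); last by ring.
rewrite ler_wpM2l// ler_pM ?sin_lipschitz//.
by apply: le_trans (ler_normD _ _) _; have := s1 s; have := s1 t; lra.
Qed.

Lemma prufer_angle_exists Q T m t0 : 0 <= T -> continuous Q ->
  exists2 th, th 0 = t0 & prufer_angle Q T m th.
Proof.
move=> T0 Qc; have [K K0 FK] := prufer_rhs_lipschitz Q T m Qc.
apply: ode_exists K0 FK _ => // th x _ thc.
have tc (f : R -> R) : continuous f -> {for x, continuous (fun z => f (th z))}.
  by move=> fc; apply: continuous_comp; [exact: thc | exact: fc].
have sc := tc _ (@continuous_sin R); have cc := tc _ (@continuous_cos R).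
rewrite /prufer_rhs; apply: (@continuousD R R R); last first.
  by apply: (@continuousM R R); [exact: cst_continuous | exact: continuousM].
have Qsc : {for x, continuous (fun z => cos (th z) + Q z * sin (th z))}.
  by apply: (@continuousD R R R) => //; apply: (@continuousM R R) => //; exact: Qc.
exact: (@continuousM R R).
Qed.

(* At a level [c] with [sin c = 0] the angle has slope 1, so it crosses only
   upwards. *)
Lemma prufer_angle_level Q T m th c a x : continuous Q -> prufer_angle Q T m th ->
  sin c = 0 -> c <= th a -> 0 <= a -> a < x -> x <= T -> c < th x.
Proof.
move=> Qc thd c0 ca a0 ax xT; have [K K0 FK] := prufer_rhs_lipschitz Q T m Qc.
pose g z := th z - c.
have zT z : a <= z <= x -> 0 <= z <= T by move=> /andP[? ?]; apply/andP; split; lra.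
have gd z : a <= z <= x -> is_derive z 1 g (prufer_rhs Q m z (th z) - 0).
  by move=> /zT zT'; apply: derivB (deriv_cst _ _); exact: thd.
have rhs1 z : a <= z <= x -> 1 - K * `|g z| <= prufer_rhs Q m z (th z) - 0.
  move=> /zT zT'; have := FK z (th z) c zT';
    rewrite (prufer_rhs_sin0 _ _ _ _ c0) ler_norml.
  by rewrite /g; lra.
have rhsK z : a <= z <= x -> - K * `|g z| <= prufer_rhs Q m z (th z) - 0.
  by move=> /rhs1; lra.
have g0 : forall z, a <= z <= x -> 0 <= g z.
  by apply: gronwall_ge0 gd rhsK _; rewrite /g; lra.
(* For strictness: the slope is at least [1 - K * g], so [expR (K * z) * g z] has derivative at
   least [expR (K * z) >= 1] and grows by at least [x - a]. *)
pose h z := expR (K * z) * g z - z.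
have : h a <= h x.
  apply: (@deriv_nondecreasing _ _ (fun z => (expR (K * z) * (prufer_rhs Q m z
    (th z) - 0) +
    g z * (expR (K * z) * K)) - 1)) => [z zx|z /andP[/ltW az /ltW zx]|];
      last exact: ltW.
    by apply: derivB; first exact: derivM (deriv_expR _ _) (gd _ zx).
  have zx' : a <= z <= x by rewrite az.
  have h1 := rhs1 z zx'; have h2 := g0 z zx'; rewrite ger0_norm// in h1.
  have z0 : 0 <= z by rewrite (le_trans a0).
  have : 1 <= expR (K * z) by rewrite -expR0 ler_expR mulr_ge0// ltW.
  by nra.
have ga : 0 <= g a by rewrite g0// lexx ltW.
have := expR_gt0 (K * a); have := expR_gt0 (K * x); rewrite /h => e1 e2.
have : 0 <= expR (K * a) * g a by rewrite mulr_ge0// ltW.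
move=> h1 h2; have : 0 < expR (K * x) * g x by lra.
by rewrite pmulr_rgt0// /g; lra.
Qed.

Lemma deriv_locally_cst (f : R -> R) a b c x d : a < x < b ->
  (forall z, a < z < b -> f z = c) -> is_derive x 1 f d -> d = 0.
Proof.
move=> xab fc fd.
have cd : is_derive x 1 (fun=> c : R) d.
  apply: near_eq_is_derive fd.
  have : x \in `]a, b[ by rewrite in_itv.
  by move=> /near_in_itvoo; apply: filterS => z; rewrite in_itv => /fc.
by rewrite -(@derive_val _ _ _ _ _ _ _ cd) derive_cst.
Qed.

Lemma prufer_rhs_diff Q m m' x s t :
  prufer_rhs Q m' x s - prufer_rhs Q m x t =
  (prufer_rhs Q m' x s - prufer_rhs Q m' x t) + (m' - m) * sin t ^+ 2.
Proof. by rewrite /prufer_rhs; ring. Qed.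

End prufer.

(** * Dependence of the angle on the spectral parameter *)

Section prufer_parameter.
Context {R : realType}.
Implicit Types (Q th : R -> R) (m s t x T K : R).

Lemma prufer_angle_diff Q T m m' th th' : prufer_angle Q T m th ->
  prufer_angle Q T m' th' -> forall x, 0 <= x <= T ->
  is_derive x 1 (fun z => th' z - th z)
    ((prufer_rhs Q m' x (th' x) - prufer_rhs Q m' x (th x)) + (m' - m) * sin
      (th x) ^+ 2).
Proof.
move=> thd thd' x xT; rewrite -prufer_rhs_diff.
by apply: derivB; [exact: thd' | exact: thd].
Qed.

(** Comparison principle: up to a Lipschitz term, the difference of the angles is driven by
    [(m' - m) * sin (th x) ^+ 2], which is nonnegative. *)
Lemma prufer_angle_le Q T m m' th th' : continuous Q -> m <= m' ->
  prufer_angle Q T m th -> prufer_angle Q T m' th' -> th 0 = th' 0 ->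
  forall x, 0 <= x <= T -> th x <= th' x.
Proof.
move=> Qc mm thd thd' th0 x xT; rewrite -subr_ge0.
have [K K0 FK] := prufer_rhs_lipschitz Q T m' Qc.
apply: (gronwall_ge0 _ K (prufer_angle_diff _ _ _ _ _ _ thd thd') _ _ _ xT).
  move=> z zT; have := FK z (th' z) (th z) zT; rewrite ler_norml => /andP[h _].
  have : 0 <= (m' - m) * sin (th z) ^+ 2 by rewrite mulr_ge0 ?sqr_ge0// subr_ge0.
  lra.
by rewrite th0 subrr.
Qed.

(** Otherwise the difference, nonnegative and nondecreasing after weighting by [expR (K * x)], would
    vanish on all of [[0, T]]. Then the driving term [(m' - m) * sin (th x) ^+ 2] would vanish too,
    so that [sin (th x)] would be constantly 0; but the angle has slope 1 where the sine is 0, so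
    the derivative of [sin (th x)] would be [cos (th x)], which is nonzero. *)
Lemma prufer_angle_lt Q T m m' th th' : continuous Q -> 0 < T -> m < m' ->
  prufer_angle Q T m th -> prufer_angle Q T m' th' -> th 0 = th' 0 ->
  th T < th' T.
Proof.
move=> Qc T0 mm thd thd' th0; rewrite ltNge; apply/negP => thT.
have [K K0 FK] := prufer_rhs_lipschitz Q T m' Qc.
pose g z := th' z - th z.
pose dg x := (prufer_rhs Q m' x (th' x) - prufer_rhs Q m' x (th x))
  + (m' - m) * sin (th x) ^+ 2.
have gd z : 0 <= z <= T -> is_derive z 1 g (dg z).
  exact: prufer_angle_diff thd thd' z.
have g0 z : 0 <= z <= T -> 0 <= g z.
  by move=> zT; rewrite subr_ge0; apply: prufer_angle_le (ltW mm) thd thd' th0 z zT.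
have gz z : 0 <= z <= T -> g z = 0.
  move=> /[dup] zT /andP[z0 zT'].
  pose h z := expR (K * z) * g z.
  suff : h z <= h T.
    have := expR_gt0 (K * z); have := expR_gt0 (K * T); have := g0 z zT.
    have : g T <= 0 by rewrite /g; lra.
    by rewrite /h; nra.
  have zzT y : z <= y <= T -> 0 <= y <= T.
    by move=> /andP[zy ->]; rewrite (le_trans z0).
  apply: (deriv_nondecreasing (fun y => expR (K * y) * dg y + g y * (expR (K *
    y) * K))) => //.
    by move=> y /zzT yT; apply: derivM (deriv_expR _ _) (gd y yT).
  move=> y /andP[/ltW zy /ltW yT]; have yT' : 0 <= y <= T by rewrite zzT// zy.
  have := FK y (th' y) (th y) yT'; rewrite ler_norml -/(g y) => /andP[h1 _].
  have h2 : 0 <= (m' - m) * sin (th y) ^+ 2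
    by rewrite mulr_ge0 ?sqr_ge0// subr_ge0 ltW.
  have gy := g0 y yT'; rewrite ger0_norm// in h1.
  have -> : expR (K * y) * dg y + g y * (expR (K * y) * K) =
    expR (K * y) * (dg y + K * g y) by ring.
  by rewrite mulr_ge0 ?expR_ge0// /dg; lra.
have sin0 x : 0 < x < T -> sin (th x) = 0.
  move=> /[dup] xT /andP[/ltW x0 /ltW xT']; have xT2 : 0 <= x <= T by rewrite x0.
  have : dg x = 0.
    apply: (deriv_locally_cst g 0 T 0 x _ xT) (gd _ xT2) => z /andP[/ltW z0
      /ltW zT].
    by rewrite gz// z0.
  have thE : th' x = th x by have := gz x xT2; rewrite /g; lra.
  rewrite /dg thE subrr add0r => /eqP; rewrite mulf_eq0 subr_eq0 gt_eqF//=.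
  by rewrite expf_eq0/= => /eqP.
have hT : 0 < T / 2 < T by apply/andP; split; lra.
have hT' : 0 <= T / 2 <= T by apply/andP; split; lra.
have := deriv_locally_cst _ _ _ _ _ _ hT sin0
  (deriv_comp _ _ _ _ _ (thd _ hT') (is_derive_sin _)).
rewrite prufer_rhs_sin0 ?sin0// mulr1 => c0.
by have := sin0_cos2 _ (sin0 _ hT); rewrite c0 expr0n/= => /eqP;
  rewrite eq_sym oner_eq0.
Qed.

(** The bound is a supersolution: its derivative is [K] times itself plus [d * expR (K * x)], and
    the last term is at least [d]. *)
Lemma gronwall_growth (g dg : R -> R) (K d T : R) : 0 <= d -> 0 <= K ->
  (forall x, 0 <= x <= T -> is_derive x 1 g (dg x)) ->
  (forall x, 0 <= x <= T -> dg x <= K * `|g x| + d) ->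
  (forall x, 0 <= x <= T -> 0 <= g x) -> g 0 = 0 ->
  forall x, 0 <= x <= T -> g x <= d * x * expR (K * x).
Proof.
move=> d0 K0 gd dgK gp g0 x xT; rewrite -subr_ge0.
have hd z : 0 <= z <= T -> is_derive z 1 (fun z => d * z * expR (K * z) - g z)
    ((d * z * (expR (K * z) * K) + expR (K * z) * d) - dg z).
  by move=> zT; apply: derivB (gd z zT);
    exact: derivM (deriv_scale _ _) (deriv_expR _ _).
apply: (gronwall_ge0 _ K hd _ _ _ xT); last by rewrite mulr0 mul0r g0 subrr.
move=> z zT; have := dgK z zT; rewrite ger0_norm ?gp//.
have /andP[z0 _] := zT.
have : 1 <= expR (K * z) by rewrite -expR0 ler_expR mulr_ge0.
have := ler_norm (- (d * z * expR (K * z) - g z)); rewrite normrN.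
set e := expR _; set n := `| _ |; move=> h1 h2 h3.
have : d <= e * d by nra.
by nra.
Qed.

(** The angles for [m] and [m'] differ at [T] by at most [|m - m'| * T * expR (K * T)]. Both orders
    of [m] and [m'] use the Lipschitz constant [K] of the fixed [m], so the bound is uniform in
    [m']. *)
Lemma prufer_angle_param_continuous Q T t0 (th : R -> R -> R) : continuous Q ->
  0 <= T -> (forall m, prufer_angle Q T m (th m)) -> (forall m, th m 0 = t0) ->
  continuous (fun m => th m T).
Proof.
move=> Qc T0 thd th0 m.
have [K K0 FK] := prufer_rhs_lipschitz Q T m Qc.
have TT : 0 <= T <= T by rewrite T0 lexx.
have sin2_le1 z : sin z ^+ 2 <= 1 :> R.
  by have := cos2Dsin2 z; have := sqr_ge0 (cos z); lra.
pose C := T * expR (K * T).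
have C0 : 0 <= C by rewrite mulr_ge0 ?expR_ge0.
have bound m' : `|th m T - th m' T| <= `|m - m'| * C.
  have [mm|/ltW mm] := leP m m'.
    have le := prufer_angle_le _ _ _ _ _ _ Qc mm (thd m) (thd m') (etrans (th0
      m) (esym (th0 m'))).
    rewrite distrC (distrC m) !ger0_norm ?subr_ge0 ?le// mulrA.
    apply: (gronwall_growth _ _ _ _ _ _ _ (fun z zT => derivB _ _ _ _ _ (thd m'
      z zT) (thd m z zT))) TT.
    - by rewrite subr_ge0.
    - exact: ltW.
    - move=> z zT; have := FK z (th m' z) (th m z) zT;
        rewrite ler_norml => /andP[_].
      have : (m' - m) * sin (th m' z) ^+ 2 <= m' - m by rewrite ler_piMr ?subr_ge0.
      by rewrite /prufer_rhs; lra.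
    - by move=> z zT; rewrite subr_ge0 le.
    - by rewrite !th0 subrr.
  have le := prufer_angle_le _ _ _ _ _ _ Qc mm (thd m') (thd m) (etrans (th0
    m') (esym (th0 m))).
  rewrite !ger0_norm ?subr_ge0 ?le// mulrA.
  apply: (gronwall_growth _ _ _ _ _ _ _ (prufer_angle_diff _ _ _ _ _ _ (thd m')
    (thd m))) TT.
  - by rewrite subr_ge0.
  - exact: ltW.
  - move=> z zT; have := FK z (th m z) (th m' z) zT; rewrite ler_norml => /andP[_].
    have : (m - m') * sin (th m' z) ^+ 2 <= m - m' by rewrite ler_piMr ?subr_ge0.
    lra.
  - by move=> z zT; rewrite subr_ge0 le.
  - by rewrite !th0 subrr.
apply/cvgrPdist_lt => e e0.
have C1 : 0 < C + 1 by lra.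
have eC : 0 < e / (C + 1) by exact: divr_gt0.
near=> m'.
have : `|m - m'| < e / (C + 1) by near: m'; exists (e / (C + 1)).
rewrite ltr_pdivlMr//; have := bound m'; have := normr_ge0 (m - m'); nra.
Unshelve. all: by end_near. Qed.

(* For [m] very negative the line from [pi - e] down to [e] is a supersolution. *)
Lemma prufer_angle_small Q T t0 e : continuous Q -> 0 < T -> t0 < pi -> 0 < e ->
  exists m, forall th, prufer_angle Q T m th -> th 0 = t0 -> th T <= e.
Proof.
move=> Qc T0 t0pi e0.
have [M M0 HM] := cont_bounded Q 0 T (fun x _ => Qc x).
have p0 := pi_gt0 R.
(* The line will run from [pi - d] to [d]: the three bounds make it end below [e], start above [t0]
   and not rise. *)
pose d := Num.min (Num.min e (pi - t0)) (pi / 2).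
have [de [dt [dp d0]]] : d <= e /\ d <= pi - t0 /\ d <= pi / 2 /\ 0 < d.
  have h1 : d <= Num.min e (pi - t0) by rewrite ge_min lexx.
  have h2 : d <= pi / 2 by rewrite ge_min lexx orbT.
  split; first by apply: le_trans h1 _; rewrite ge_min lexx.
  split; first by apply: le_trans h1 _; rewrite ge_min lexx orbT.
  by rewrite h2 !lt_min e0 subr_gt0 t0pi divr_gt0.
have dpi : d <= pi - d by lra.
have [c cd cmin] := EVT_min dpi (continuous_subspaceT (@continuous_sin R)).
have sc0 : 0 < sin c.
  by move: cd; rewrite in_itv/= => /andP[? ?]; apply: sin_gt0_pi; apply/andP;
    split; lra.
pose k := (pi - d - d) / T.
have k0 : 0 <= k by apply: divr_ge0; [lra | exact: ltW].
pose N := k + (1 + M) ^+ 2.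
have N0 : 0 <= N by rewrite addr_ge0 ?sqr_ge0.
(* On [[d, pi - d]] the sine is at least [sin c > 0], so the term with [m] is at most [- N]. It
   outweighs the square, bounded by [(1 + M) ^+ 2], and leaves a slope at most [- k], that of the
   line. *)
exists (- N / sin c ^+ 2) => th thd th0.
set m := - N / _ in thd.
have [K K0 FK] := prufer_rhs_lipschitz Q T m Qc.
have m0 : m <= 0 by rewrite /m mulNr oppr_le0 divr_ge0 ?sqr_ge0.
have msc : m * sin c ^+ 2 = - N by rewrite /m divfK// sqrf_eq0 gt_eqF.
pose l z := (pi - d) - k * z.
have TT : 0 <= T <= T by rewrite lexx ltW.
have ld x : 0 <= x <= T -> is_derive x 1 (fun z => l z - th z)
    ((0 - k) - prufer_rhs Q m x (th x)).
  by move=> xT; apply: derivB (thd x xT);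
    exact: derivB (deriv_cst _ _) (deriv_scale _ _).
have kT : k * T = pi - d - d by rewrite /k divfK// gt_eqF.
suff : 0 <= l T - th T by rewrite /l kT; lra.
apply: (gronwall_ge0 _ K ld _ _ _ TT); last by rewrite /l mulr0 th0; lra.
move=> z zT; have := FK z (l z) (th z) zT; rewrite ler_norml => /andP[h _].
suff : prufer_rhs Q m z (l z) <= - k by lra.
have /andP[z0 zT'] := zT.
have : sin c <= sin (l z).
  apply: cmin; rewrite in_itv/= /l; have : k * z <= k * T by rewrite ler_wpM2l.
  have : 0 <= k * z by rewrite mulr_ge0.
  by rewrite kT => h1 h2; apply/andP; split; lra.
move=> sl; have sl2 : sin c ^+ 2 <= sin (l z) ^+ 2 by rewrite ler_sqr// nnegrE; lra.
have h2 : m * sin (l z) ^+ 2 <= - N by rewrite -msc ler_wnM2l.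
have : (cos (l z) + Q z * sin (l z)) ^+ 2 <= (1 + M) ^+ 2.
  rewrite -real_normK ?num_real// ler_sqr ?nnegrE//; last by lra.
  apply: le_trans (ler_normD _ _) _; rewrite lerD//.
    by rewrite ler_norml cos_geN1 cos_le1.
  rewrite normrM -[M]mulr1 ler_pM ?HM//.
  by rewrite ler_norml sin_geN1 sin_le1.
by rewrite /prufer_rhs /N in h2 *; lra.
Qed.

End prufer_parameter.

(** * Counting the levels met by the angle, and the Pruefer radius *)

Section prufer_zeros.
Context {R : realType}.
Implicit Types (Q th : R -> R) (m s t x T K : R).

Lemma prufer_angle_ge_level Q T m th c a x : continuous Q ->
  prufer_angle Q T m th ->
  sin c = 0 -> c <= th a -> 0 <= a -> a <= x -> x <= T -> c <= th x.
Proof.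
move=> Qc thd c0 ca a0; rewrite le_eqVlt => /predU1P[<-//|ax xT].
exact/ltW/(prufer_angle_level Q T m th c a).
Qed.

Lemma prufer_angle_level_inj Q T m th x y : continuous Q -> prufer_angle Q T m th ->
  0 <= x <= T -> 0 <= y <= T -> sin (th x) = 0 -> th x = th y -> x = y.
Proof.
move=> Qc thd /andP[x0 xT] /andP[y0 yT] sx xy.
have lev := prufer_angle_level Q T m th (th x) _ _ Qc thd sx.
have [xy'|yx|//] := ltgtP x y.
  by have := lev x y (lexx _) x0 xy' yT; rewrite xy ltxx.
by have := lev y x; rewrite {1}xy lexx => /(_ isT y0 yx xT); rewrite ltxx.
Qed.

Lemma prufer_angle_level_exists Q T m th c : 0 <= T -> prufer_angle Q T m th ->
  th 0 <= c <= th T -> exists2 x, 0 <= x <= T & th x = c.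
Proof.
move=> T0 thd /andP[c1 c2].
have thc : {within `[0, T], continuous th}.
  by apply: cont_within => x /thd /deriv_cont.
have [|x] := @IVT R th 0 T c T0 thc; last by rewrite in_itv/=; exists x.
by rewrite ge_min c1 le_max c2 orbT.
Qed.

Lemma card_levels (D : set R) th (o k : nat) :
  (forall x y, D x -> D y -> sin (th x) = 0 -> th x = th y -> x = y) ->
  (forall j, (j < k)%N -> exists2 x, D x & th x = (o + j)%:R * pi) ->
  (forall x, D x -> sin (th x) = 0 -> exists2 j,
    (j < k)%N & th x = (o + j)%:R * pi) ->
  [set x | D x /\ sin (th x) = 0] #= `I_k.
Proof.
move=> inj ex lev.
have /choice[f Hf] : forall j, exists x, (j < k)%N -> D x /\ th x = (o + j)%:R * pi.
  move=> j; have [/ex[x Dx xj]|_] := boolP (j < k)%N; first by exists x.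
  by exists 0.
have -> : [set x | D x /\ sin (th x) = 0] = f @` `I_k.
  apply/seteqP; split => [x [Dx sx]|_ [j /= jk <-]].
    have [j jk xj] := lev x Dx sx; have [Dfj fj] := Hf j jk.
    by exists j => //; apply/esym/inj => //; rewrite fj.
  by have [Dfj fj] := Hf j jk; split=> //; rewrite fj sin_natpi.
apply: inj_card_eq => i j; rewrite !inE/= => ik jk fij.
have [_ fi] := Hf i ik; have [_ fj] := Hf j jk.
have pn : pi != 0 :> R by rewrite gt_eqF ?pi_gt0.
have /(mulIf pn)/eqP := etrans (esym fi) (etrans (congr1 th fij) fj).
by rewrite eqr_nat eqn_add2l => /eqP.
Qed.

(** On the closed interval the levels met are those between the two end values of the angle. The
    first index [o] will be 0 when the angle starts at 0 and 1 when it starts inside [(0, pi)]. *)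
Lemma prufer_zeros_closed Q T m th (o n : nat) : continuous Q -> 0 <= T ->
  prufer_angle Q T m th -> 0 <= th 0 ->
  (forall j : nat, (o <= j < o + n)%N = (th 0 <= j%:R * pi <= th T)) ->
  [set x | 0 <= x <= T /\ sin (th x) = 0] #= `I_n.
Proof.
move=> Qc T0 thd th0 levE; apply: (card_levels _ _ o).
- by move=> x y xT yT; exact: prufer_angle_level_inj thd xT yT.
- move=> j jn; apply: prufer_angle_level_exists thd _ => //.
  by rewrite -levE leq_addr ltn_add2l.
- move=> x /andP[x0 xT] sx.
  have thx : 0 <= th x by apply: (prufer_angle_ge_level Q T m th 0 0) => //;
    exact: sin0.
  have [j xj] := sin_eq0_natpi _ thx sx.
  have /andP[oj jn] : (o <= j < o + n)%N.
    rewrite levE -xj; apply/andP; split.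
      (* A level below [th 0] stays strictly below the angle at every later point, so it cannot be
         [th x]. *)
      rewrite leNgt; apply/negP => h.
      move: x0; rewrite le_eqVlt => /predU1P[x0|x0]; first by rewrite -x0 ltxx in h.
      by have := prufer_angle_level Q T m th _ _ _ Qc thd sx (ltW h) (lexx _)
        x0 xT; rewrite ltxx.
    exact: (prufer_angle_ge_level Q T m th (th x) x).
  exists (j - o)%N; last by rewrite subnKC.
  by rewrite ltn_subLR.
Qed.

Lemma prufer_zeros_open Q T m th (k : nat) : continuous Q -> 0 <= T ->
  prufer_angle Q T m th -> 0 <= th 0 < pi ->
  k%:R * pi < th T <= k.+1%:R * pi ->
  [set x | 0 < x < T /\ sin (th x) = 0] #= `I_k.
Proof.
move=> Qc T0 thd /andP[th0 th0pi] /andP[kT Tk]; have p0 := pi_gt0 R.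
apply: (card_levels _ _ 1).
- move=> x y /andP[/ltW x0 /ltW xT] /andP[/ltW y0 /ltW yT].
  by apply: prufer_angle_level_inj thd _ _ => //; apply/andP.
- move=> j jk; have [|x] := prufer_angle_level_exists Q T m th ((1 + j)%:R *
    pi) T0 thd.
    apply/andP; split; last by apply/ltW; apply: le_lt_trans kT;
      rewrite ler_pM2r// ler_nat.
    by apply/ltW; apply: lt_le_trans th0pi _; rewrite ler_peMl ?ler1n ?(ltW p0).
  move=> /andP[x0 xT] xj; exists x => //; apply/andP; split.
    rewrite lt_neqAle x0 andbT; apply/eqP => xE; move: th0pi; rewrite xE xj ltNge.
    by rewrite ler_peMl ?ler1n ?(ltW p0).
  rewrite lt_neqAle xT andbT; apply/eqP => xE; move: kT; rewrite -xE xj ltNge.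
  by rewrite ler_pM2r// ler_nat add1n jk.
- move=> x /andP[x0 xT] sx.
  have thx : 0 < th x by apply: (prufer_angle_level Q T m th 0 0) => //;
    [exact: sin0 | exact: ltW].
  have [j xj] := sin_eq0_natpi _ (ltW thx) sx.
  have j0 : (0 < j)%N by rewrite -(ltr_nat R) -(pmulr_lgt0 _ p0) -xj.
  exists j.-1; last by rewrite add1n prednK.
  rewrite prednK// -ltnS -(ltr_nat R) -(ltr_pM2r p0) -xj.
  apply: lt_le_trans Tk.
  exact: (prufer_angle_level Q T m th (th x) x _ _ _ _ _ (ltW x0)).
Qed.

(* [y' = Q y + u, u' = - (m + Q^2) y - Q u] is the regularized form of
   [- y'' + Q' y = m y], with quasi-derivative [u = y' - Q y]. *)
Definition regular_solution Q T m (y u : R -> R) :=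
  forall x : R, 0 <= x <= T ->
    is_derive x 1 y (Q x * y x + u x) /\
    is_derive x 1 u (- (m + Q x ^+ 2) * y x - Q x * u x).

(** From [r r' = y y' + u u'] the logarithmic derivative of the radius is the function [g] below, so
    [r] is the exponential of its primitive vanishing at 0. *)
Lemma regular_solution_exists Q T m th : continuous Q -> 0 <= T ->
  prufer_angle Q T m th ->
  exists r : R -> R, [/\ r 0 = 1, forall x, 0 < r x &
    regular_solution Q T m (fun x => r x * sin (th x)) (fun x => r x * cos (th x))].
Proof.
move=> Qc T0 thd.
pose g x := Q x * (sin (th x) ^+ 2 - cos (th x) ^+ 2) + (1 - m - Q x ^+ 2) *
  (sin (th x) * cos (th x)).
have gc x : 0 <= x <= T -> {for x, continuous g}.
  move=> xT; have thc := deriv_cont _ _ _ (thd x xT).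
  have tc (f : R -> R) : continuous f -> {for x, continuous (fun z => f (th z))}.
    by move=> fc; apply: continuous_comp; [exact: thc | exact: fc].
  have sc := tc _ (@continuous_sin R); have cc := tc _ (@continuous_cos R).
  have mc (f h : R -> R) : {for x, continuous f} -> {for x, continuous h} ->
    {for x, continuous (fun z => f z * h z)} by move=> fc hc;
      exact: (@continuousM R R).
  have bc (f h : R -> R) : {for x, continuous f} -> {for x, continuous h} ->
    {for x, continuous (fun z => f z - h z)} by move=> fc hc;
      exact: (@continuousB R R R).
  have kc (c : R) : {for x, continuous (fun=> c)} by exact: cst_continuous.
  have Qx := Qc x.
  apply: (@continuousD R R R).
    by apply: (mc) => //; apply: bc; exact: (mc).
  by apply: (mc); [apply: (bc); [exact: kc | exact: (mc)] | exact: (mc)].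
have [A A0 Ad] := primitive_exists T g T0 gc.
exists (fun x => expR (A x)); split.
- by rewrite A0 expR0.
- by move=> x; exact: expR_gt0.
- move=> x xT.
  have ed := deriv_comp _ _ _ _ _ (Ad x xT) (is_derive_expR _).
  have sd := deriv_comp _ _ _ _ _ (thd x xT) (is_derive_sin _).
  have cd := deriv_comp _ _ _ _ _ (thd x xT) (is_derive_cos _).
  have c2 : cos (th x) ^+ 2 = 1 - sin (th x) ^+ 2
    by rewrite -(cos2Dsin2 (th x)) addrK.
  have id1 (s c : R) : c ^+ 2 = 1 - s ^+ 2 ->
    s * (Q x * (s ^+ 2 - c ^+ 2) + (1 - m - Q x ^+ 2) * (s * c))
    + c * ((c + Q x * s) ^+ 2 + m * s ^+ 2) = Q x * s + c.
    by move=> c2'; ring: c2'.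
  have id2 (s c : R) : c ^+ 2 = 1 - s ^+ 2 ->
    c * (Q x * (s ^+ 2 - c ^+ 2) + (1 - m - Q x ^+ 2) * (s * c))
    - s * ((c + Q x * s) ^+ 2 + m * s ^+ 2) = - (m + Q x ^+ 2) * s - Q x * c.
    by move=> c2'; ring: c2'.
  split.
    apply: is_derive_eq (derivM _ _ _ _ _ ed sd) _.
    rewrite /prufer_rhs /g.
    by transitivity (expR (A x) * (Q x * sin (th x) + cos (th x)));
      [rewrite -(id1 _ _ c2); ring|ring].
  apply: is_derive_eq (derivM _ _ _ _ _ ed cd) _.
  rewrite /prufer_rhs /g.
  by transitivity (expR (A x) * (- (m + Q x ^+ 2) * sin (th x) - Q x * cos (th x)));
    [rewrite -(id2 _ _ c2); ring|ring].
Qed.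

End prufer_zeros.

(** * Absolute continuity *)

Section absolute_continuity.
Context {R : realType}.
Implicit Types (f g : R -> R) (x a b T : R).
Local Notation mu := (@lebesgue_measure R).

Lemma sum_disjoint_le_measure m (u v : 'I_m -> R) (U : set R) :
  measurable U -> (forall i, u i <= v i) ->
  trivIset [set: 'I_m] (fun i => `]u i, v i[%classic) ->
  (forall i, `]u i, v i[ `<=` U) -> ((\sum_(i < m) (v i - u i))%:E <= mu U)%E.
Proof.
move=> mU uv tI IU.
have -> : (\sum_(i < m) (v i - u i))%:E = (\sum_(i < m) mu `]u i, v i[%classic)%E.
  rewrite -sumEFin; apply: eq_bigr => i _.
  rewrite lebesgue_measure_itv/= lte_fin; case: ltP => // h.
  by rewrite (_ : v i = u i) ?subrr//; apply/eqP; rewrite eq_le h uv.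
rewrite -measure_bigsetU_ord//.
apply: le_measure; rewrite ?inE//.
  by apply: bigsetU_measurable => i _; exact: measurable_itv.
by elim/big_ind : _ => [|A B hA hB|i _];
  [exact: sub0set | rewrite subUset | exact: IU].
Qed.

Lemma abs_continuousS a b b' f : b' <= b ->
  abs_continuous a b f -> abs_continuous a b' f.
Proof.
move=> bb fac e /fac[d d0 H]; exists d => // m u v uv; apply: H => i.
by have [? [? h]] := uv i; split => //; split => //; exact: le_trans h bb.
Qed.

Lemma abs_continuous_modulus a b f e : abs_continuous a b f -> 0 < e ->
  exists2 d, 0 < d & forall x y, a <= x <= b -> a <= y <= b -> `|y - x| < d ->
    `|f y - f x| < e.
Proof.
move=> fac /fac[d d0 H]; exists d => // x y.
wlog xy : x y / x <= y.
  move=> W; have [xy|/ltW yx] := leP x y; first exact: W.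
  by move=> xab yab; rewrite distrC (distrC (f y)); exact: W.
move=> /andP[ax xb] /andP[ay yb]; rewrite ger0_norm ?subr_ge0// => xyd.
have := H 1%N (fun=> x) (fun=> y); rewrite !big_ord1; apply => //.
by move=> i j _ _ _; rewrite (ord1 i) (ord1 j).
Qed.

Lemma abs_continuous_clamp T f : 0 <= T -> abs_continuous 0 T f ->
  continuous (f \o clamp T).
Proof.
move=> T0 fac x; apply/cvgrPdist_lt => e /(abs_continuous_modulus _ _ _ _
  fac)[d d0 H].
have /cvgrPdist_lt/(_ d d0) := @clamp_continuous R T x.
by apply: filterS => y xy; apply: H => //; exact: clamp_itv.
Qed.

Lemma abs_continuous_bounded T f : 0 <= T -> abs_continuous 0 T f ->
  exists2 M, 0 < M & forall x : R, 0 <= x <= T -> `|f x| <= M.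
Proof.
move=> T0 /(abs_continuous_clamp _ _ T0) fc.
have [M M0 HM] := cont_bounded _ 0 T (fun x _ => fc x).
exists (M + 1) => [|x xT]; first by lra.
by have := HM x xT; rewrite /= clamp_id//; lra.
Qed.

Lemma abs_continuousD a b f g : abs_continuous a b f -> abs_continuous a b g ->
  abs_continuous a b (fun x => f x + g x).
Proof.
move=> fac gac e e0; have e2 : 0 < e / 2 by rewrite divr_gt0.
have [d1 d10 H1] := fac _ e2; have [d2 d20 H2] := gac _ e2.
exists (Num.min d1 d2) => [|m u v uv tI]; first by rewrite lt_min d10.
rewrite lt_min => /andP[/(H1 m u v uv tI) h1 /(H2 m u v uv tI) h2].
have : \sum_(i < m) `|f (v i) + g (v i) - (f (u i) + g (u i))| <=
    \sum_(i < m) `|f (v i) - f (u i)| + \sum_(i < m) `|g (v i) - g (u i)|.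
  rewrite -big_split/=; apply: ler_sum => i _.
  by rewrite opprD addrACA ler_normD.
lra.
Qed.

Lemma abs_continuousM T f g : 0 <= T -> abs_continuous 0 T f ->
  abs_continuous 0 T g ->
  abs_continuous 0 T (fun x => f x * g x).
Proof.
move=> T0 fac gac e e0.
have [A A0 HA] := abs_continuous_bounded _ _ T0 fac.
have [B B0 HB] := abs_continuous_bounded _ _ T0 gac.
have e2 : 0 < e / 2 by rewrite divr_gt0.
have [d1 d10 H1] := fac (e / 2 / B) (divr_gt0 e2 B0).
have [d2 d20 H2] := gac (e / 2 / A) (divr_gt0 e2 A0).
exists (Num.min d1 d2) => [|m u v uv tI]; first by rewrite lt_min d10.
rewrite lt_min => /andP[/(H1 m u v uv tI) h1 /(H2 m u v uv tI) h2].
rewrite ltr_pdivlMr// in h1; rewrite ltr_pdivlMr// in h2.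
apply: (@le_lt_trans _ _ ((\sum_(i < m) `|f (v i) - f (u i)|) * B +
    (\sum_(i < m) `|g (v i) - g (u i)|) * A)); last by lra.
rewrite !mulr_suml -big_split/=; apply: ler_sum => i _.
have [u0 [uvi vT]] := uv i.
have -> : f (v i) * g (v i) - f (u i) * g (u i) =
  (f (v i) - f (u i)) * g (v i) + (g (v i) - g (u i)) * f (u i) by ring.
apply: le_trans (ler_normD _ _) _; rewrite !normrM lerD// ler_wpM2l//.
  by apply: HB; rewrite vT (le_trans u0).
by apply: HA; rewrite u0 (le_trans uvi).
Qed.

Lemma lipschitz_abs_continuous a b f K : 0 <= K ->
  (forall x y, a <= x <= b -> a <= y <= b -> `|f x - f y| <= K * `|x - y|) ->
  abs_continuous a b f.
Proof.
move=> K0 fK e e0; have K1 : 0 < K + 1 by lra.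
exists (e / (K + 1)) => [|m u v uv _]; first exact: divr_gt0.
rewrite ltr_pdivlMr// => h.
apply: (@le_lt_trans _ _ (K * \sum_(i < m) (v i - u i))).
  rewrite mulr_sumr; apply: ler_sum => i _.
  have [au [uvi vb]] := uv i.
  rewrite -[v i - _]ger0_norm ?subr_ge0//; apply: fK.
    by rewrite vb (le_trans au).
  by rewrite au (le_trans uvi).
have : 0 <= \sum_(i < m) (v i - u i).
  by apply: sumr_ge0 => i _; rewrite subr_ge0; have [_ []] := uv i.
by move=> S0; nra.
Qed.

Lemma deriv_abs_continuous f df a b :
  (forall x, a <= x <= b -> is_derive x 1 f (df x)) ->
  (forall x, a <= x <= b -> {for x, continuous df}) -> abs_continuous a b f.
Proof.
move=> fd dfc; have [M M0 HM] := cont_bounded _ _ _ dfc.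
apply: (lipschitz_abs_continuous _ _ _ M) => // x y.
wlog yx : x y / y <= x.
  move=> W; have [yx|/ltW xy] := leP y x; first exact: W.
  by move=> ? ?; rewrite distrC (distrC x); exact: W.
move=> /andP[ax xb] /andP[ay yb].
have zab z : y <= z <= x -> a <= z <= b.
  by move=> /andP[yz zx]; rewrite (le_trans ay)//= (le_trans zx).
have [c cyx ->] := MVT_closed df (fun z zyx => fd z (zab z zyx)) yx.
by rewrite normrM ler_wpM2r// HM// zab.
Qed.

Lemma abs_continuous_cst a b (c : R) : abs_continuous a b (fun=> c).
Proof.
apply: (lipschitz_abs_continuous _ _ _ 0) => // x y _ _.
by rewrite subrr normr0 mul0r.
Qed.

Lemma deriv0_increment f (s e : R) : is_derive s 1 f 0 -> 0 < e ->
  exists2 r, 0 < r & forall z, `|z - s| < r -> `|f z - f s| <= e * `|z - s|.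
Proof.
move=> /is_derive1_caratheodory[g [fE gc g0]] e0.
have [r /= r0 H] := (cvgrPdist_lt _ _).1 gc e e0.
exists r => // z zs; rewrite fE normrM ler_wpM2r//.
by have := H z; rewrite /= distrC => /(_ zs); rewrite g0 sub0r normrN => /ltW.
Qed.

(* [x] is reached from [0] through finitely many ordered intervals inside [U],
   on the complement of which [f] grows at rate at most [e]. *)
Let reachable f (U : set R) e x := exists (m : nat) (u v : nat -> R),
  [/\ forall i, (i < m)%N -> 0 <= u i /\ u i <= v i /\ v i <= x,
      forall i j, (i < j < m)%N -> v i <= u j,
      forall i, (i < m)%N -> `]u i, v i[ `<=` U &
      `|f x - f 0| <= e * x + \sum_(i < m) `|f (v i) - f (u i)|].

Let reachable_slope f U e x y : x <= y -> `|f y - f x| <= e * (y - x) ->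
  reachable f U e x -> reachable f U e y.
Proof.
move=> xy fxy [m [u [v [uv ord IU fx]]]]; exists m, u, v; split => //.
  by move=> i /uv[? [? vx]]; split => //; split => //; exact: le_trans vx xy.
have := ler_distD (f x) (f y) (f 0); lra.
Qed.

Let reachable_open f U e x y : 0 <= e -> 0 <= x -> x <= y -> `]x, y[ `<=` U ->
  reachable f U e x -> reachable f U e y.
Proof.
move=> e0 x0 xy xyU [m [u [v [uv ord IU fx]]]].
exists m.+1, (fun i => if i == m then x else u i),
  (fun i => if i == m then y else v i).
split.
- move=> i; rewrite ltnS leq_eqVlt; case: eqVneq => [_ _|_ /= /uv[? [? vx]]] //.
  by split => //; split => //; exact: le_trans vx xy.
- move=> i j /andP[ij]; rewrite ltnS leq_eqVlt => /predU1P[jm|jm].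
    by rewrite jm eqxx; rewrite jm in ij; rewrite ltn_eqF//; have [_ []] := uv i ij.
  by rewrite !ltn_eqF ?(ltn_trans ij)//; apply: ord; rewrite ij.
- by move=> i; rewrite ltnS leq_eqVlt; case: eqVneq => //= _; exact: IU.
- rewrite big_ord_recr/= eqxx.
  under eq_bigr => i _ do rewrite ltn_eqF//.
  have := ler_distD (f x) (f y) (f 0).
  have : e * x <= e * y by rewrite ler_wpM2l.
  lra.
Qed.

(** The exceptional null set is covered by an open [U] of small measure. Moving right from 0, either
    a small slope or an interval inside [U] allows an advance; a supremum argument takes this up to
    [T], and absolute continuity controls the part spent in [U]. *)
Lemma abs_continuous_deriv0 f T : 0 <= T -> abs_continuous 0 T f ->
  {ae mu, forall x : R, x \in `]0, T[ -> is_derive x 1 f 0} -> f T = f 0.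
Proof.
move=> T0 fac [N [mN N0 Nsub]].
suff eps e : 0 < e -> `|f T - f 0| <= e.
  by apply/eqP; rewrite -subr_eq0 -normr_le0; apply/ler_addgt0Pl => e /eps;
    rewrite addr0.
move=> e0.
pose e1 := e / 2 / (T + 1).
have e10 : 0 < e1 by rewrite !divr_gt0//; lra.
have e2 : 0 < e / 2 by rewrite divr_gt0.
have [d d0 Hd] := fac _ e2.
have d2 : 0 < d / 2 by rewrite divr_gt0.
(* The endpoints join the null set, since the derivative is known only inside [(0, T)]. *)
pose E := N `|` [set 0] `|` [set T].
have E0 : mu E = 0%E.
  apply: measure_negligible; first by do 2 apply: measurableU => //.
  by do 2 (apply: negligibleU; last by apply/negligibleP => //;
    exact: lebesgue_measure_set1);
    apply/negligibleP.
have [U [oU EU]] := outer_measure_open_le E d2.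
rewrite -[X in (_ <= X + _)%E]/(mu E) E0 add0e => muU.
pose A := [set x | 0 <= x <= T /\ reachable f U e1 x].
have A0 : A 0.
  split; first by rewrite lexx.
  by exists 0%N, (fun=> 0), (fun=> 0); split => //;
    rewrite big_ord0 subrr normr0 mulr0 addr0.
have supA : has_sup A by split; [exists 0 | exists T => x [/andP[]]].
set s := sup A.
have s0 : 0 <= s by exact: (sup_upper_bound supA).
have sT : s <= T by apply: ge_sup => [|x [/andP[]]//]; exists 0.
(* Near [s], reachability passes from the left of [s] to its right: through an interval inside [U]
   if [s] is exceptional, with slope at most [e1] otherwise. *)
have [r r0 Hr] : exists2 r, 0 < r & forall x y, s - r < x -> x <= s -> s <= y ->
  y < s + r ->
    0 <= x -> reachable f U e1 x -> reachable f U e1 y.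
  have [sE|sE] := pselect (E s).
    have [r /= r0 Hr] : nbhs s U by apply: open_nbhs_nbhs; split => //; exact: EU.
    exists r => // x y srx xs sy ysr x0.
    apply: reachable_open => //; [exact: ltW | exact: le_trans sy|].
    move=> z /=; rewrite in_itv/= => /andP[xz zy]; apply: Hr => /=.
    by rewrite ltr_distlC; lra.
  have sd : is_derive s 1 f 0.
    apply: contrapT => nd; apply: (sE); left; left; apply: Nsub => /= h;
      apply: nd; apply: h.
    rewrite in_itv/= !lt_neqAle s0 sT !andbT; apply/andP; split; apply/eqP => s0T.
      by apply: sE; left; right.
    by apply: sE; right.
  have [r r0 Hr] := deriv0_increment f s e1 sd e10.
  exists r => // x y srx xs sy ysr x0.
  have fxs : `|f s - f x| <= e1 * (s - x).
    have := Hr x; rewrite distrC ger0_norm ?subr_ge0// distrC; apply.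
    by lra.
  have fsy : `|f y - f s| <= e1 * (y - s).
    have := Hr y; rewrite ger0_norm ?subr_ge0//; apply.
    by lra.
  by move=> /(reachable_slope _ _ _ _ _ xs fxs)/(reachable_slope _ _ _ _ _ sy fsy).
have [x [/andP[x0 xT] rx] srx] := sup_adherent r0 supA.
have xs : x <= s by apply: (sup_upper_bound supA); split => //; rewrite x0.
have rs : reachable f U e1 s by apply: (Hr x) => //; lra.
have sE : s = T.
  apply/eqP; rewrite eq_le sT leNgt; apply/negP => sltT.
  pose y := Num.min (s + r / 2) T.
  have y1 : y <= s + r / 2 by rewrite ge_min lexx.
  have y2 : y <= T by rewrite ge_min lexx orbT.
  have sy : s < y by rewrite lt_min sltT; lra.
  suff : y <= s by lra.
  apply: (sup_upper_bound supA); split; first by rewrite y2 andbT; lra.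
  by apply: (Hr x) => //; lra.
(* The chosen intervals have total length at most [d / 2], so they contribute less than [e / 2]; the
   rest contributes at most [e1 * T <= e / 2]. *)
rewrite sE in rs; have [m [u [v [uv ord IU fT]]]] := rs.
pose u' (i : 'I_m) := u i; pose v' (i : 'I_m) := v i.
have uv' i : 0 <= u' i /\ u' i <= v' i /\ v' i <= T by exact: uv.
have tI : trivIset [set: 'I_m] (fun i => `]u' i, v' i[%classic).
  move=> i j _ _ [z [/=]]; rewrite !in_itv/= => /andP[uz zv] /andP[uz' zv'].
  have [ij|ji|/val_inj//] := ltngtP i j.
    by have := ord i j; rewrite ij ltn_ord leNgt (lt_trans uz' zv) => /(_ isT).
  by have := ord j i; rewrite ji ltn_ord leNgt (lt_trans uz zv') => /(_ isT).
have := Hd m u' v' uv' tI.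
have : \sum_(i < m) (v' i - u' i) < d.
  apply: (@le_lt_trans _ _ (d / 2)); last by lra.
    rewrite -lee_fin; apply: le_trans muU; apply: sum_disjoint_le_measure => //.
    - exact: measurable_realfun.open_measurable.
    - by move=> i; have [_ []] := uv' i.
    - by move=> i; exact: IU.
move=> h /(_ h); rewrite /u' /v' => h1.
have : e1 * T <= e / 2.
  rewrite /e1 -mulrA ler_piMr//; first by lra.
  by rewrite mulrC ler_pdivrMr; lra.
lra.
Qed.

End absolute_continuity.

(** * Primitives of summable functions *)

Section L1_primitive.
Context {R : realType}.
Implicit Types (f g : R -> R) (x a b T : R).
Local Notation mu := (@lebesgue_measure R).

(** The increments over disjoint intervals sum to at most the integral of [|f|] over their union,
    which is small when the union has small measure. *)
Lemma integral_abs_continuous f T : mu.-integrable setT (EFin \o f) ->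
  abs_continuous 0 T (fun x => \int[mu]_(t in `]-oo, x]) f t).
Proof.
move=> fi e e0; have [d [d0 Hd]] := integral_normr_continuous fi e0.
exists d => // m u v uv tI uvd.
pose F (i : 'I_m) : set R := `]u i, v i[%classic.
have mF i : measurable (F i) by exact: measurable_itv.
have uvi i : u i <= v i by have [_ []] := uv i.
have fS A : measurable A -> mu.-integrable A (EFin \o f).
  by move=> mA; apply: integrableS fi.
have fI (I : interval R) : mu.-integrable [set` I] (EFin \o f).
  by apply: fS; exact: measurable_itv.
have incr i : `|\int[mu]_(t in `]-oo, v i]) f t - \int[mu]_(t in `]-oo, u i]) f t|
    <= \int[mu]_(t in F i) `|f t|.
  rewrite Rintegral_itvB ?bnd_simp ?fI// -Rintegral_itv_bndo_bndc ?fI//.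
  by apply: le_normr_Rintegral; [exact: measurable_itv | exact: fI].
apply: le_lt_trans (ler_sum _ (fun i _ => incr i)) _.
have nfi A : measurable A -> mu.-integrable A (EFin \o (fun t => `|f t|)).
  by move=> mA; apply: integrable_norm; exact: fS.
pose D := \big[setU/set0]_(i < m) F i.
have mD : measurable D by exact: bigsetU_measurable.
have -> : \sum_(i < m) \int[mu]_(t in F i) `|f t| = \int[mu]_(t in D) `|f t|.
  apply: EFin_inj; rewrite -sumEFin.
  rewrite /Rintegral fineK; last by apply: integrable_fin_num => //; exact: nfi.
  rewrite /D integral_bigsetU_EFin//=.
  - apply: eq_bigr => i _; rewrite fineK//.
    by apply: integrable_fin_num; [exact: mF | exact: (nfi _ (mF i))].
  - exact: index_enum_uniq.
  - exact: sub_trivIset tI.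
  - by have /integrableP[] := nfi _ mD.
apply: Hd => //.
rewrite /D measure_bigsetU_ord//.
apply: le_lt_trans (_ : (\sum_(i < m) mu (F i) <= (\sum_(i < m) (v i - u
  i))%:E)%E) _; last by rewrite lte_fin.
rewrite -sumEFin; apply: lee_sum => i _.
by rewrite lebesgue_measure_itv/= lte_fin; case: ltP => // _;
  rewrite lee_fin subr_ge0.
Qed.

Lemma L1_primitive_exists T (q : R -> R) : 0 < T -> in_L1 `[0, T] q ->
  exists Q : R -> R, [/\ continuous Q, Q 0 = 0, abs_continuous 0 T Q &
    {ae mu, forall x : R, x \in `]0, T[ -> is_derive x 1 Q (q x)}].
Proof.
move=> T0 [p pi_ qp]; have TT := ltW T0.
(* Extension by 0 gives a function integrable on the whole line, to which Lebesgue differentiation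
   of the integral from [-oo] applies. *)
pose f := p \_ `[0, T].
have fi : mu.-integrable setT (EFin \o f).
  by rewrite -restrict_EFin -integrable_mkcond.
pose F x := \int[mu]_(t in `]-oo, x]) f t.
have Fac : abs_continuous 0 T F by exact: integral_abs_continuous.
pose Q x := F (clamp T x) - F 0.
have QE x : 0 <= x <= T -> Q x = F x - F 0 by move=> xT; rewrite /Q clamp_id.
exists Q; split.
- move=> x; apply: (@continuousB R R R (F \o clamp T) (fun=> F 0));
    last exact: cst_continuous.
  exact: (abs_continuous_clamp _ _ TT Fac).
- by rewrite QE ?subrr// lexx.
- move=> e /Fac[d d0 H]; exists d => // m u v uv tI uvd.
  have := H m u v uv tI uvd; congr (_ < _); apply: eq_bigr => i _.
  have [u0 [uvi vT]] := uv i.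
  rewrite !QE ?u0 ?vT ?(le_trans uvi)// ?(le_trans u0)//.
  by rewrite opprB addrA subrK.
have fint y : mu.-integrable `]-oo, y] (EFin \o f).
  by apply: integrableS fi => //; exact: measurable_itv.
have floc : locally_integrable setT f.
  by apply: open_integrable_locally => //; exact: openT.
have := FTC1Ny fint floc; apply: filterS2 qp;
  first exact: (ae_filter_ringOfSetsType mu).
move=> x qpx [dF F'] xT.
have /andP[x0 xT'] : 0 < x < T by move: xT; rewrite in_itv.
have xT2 : `[0, T]%classic x by rewrite /= in_itv/= !ltW.
have dQ : is_derive x 1 (fun z => F z - F 0) (q x).
  rewrite -[q x]subr0; apply: derivB (deriv_cst _ _).
  apply: DeriveDef => //; rewrite -derive1E F' /f patchE mem_set// qpx//.
apply: near_eq_is_derive dQ.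
move: (near_in_itvoo xT); apply: filterS => z; rewrite in_itv/= => /andP[z0 zT].
by rewrite QE// !ltW.
Qed.

End L1_primitive.

(** * Derivatives relative to a set and two-sided derivatives *)

Section one_sided.
Context {R : realType}.
Implicit Types (f g : R -> R) (x a b T : R).

Lemma is_derive_withinP D f x l : is_derive_within D f x l <->
  forall e, 0 < e -> exists2 r, 0 < r & forall z, z != x -> D z -> `|z - x| < r ->
    `|l - (f z - f x) / (z - x)| < e.
Proof.
split=> [/cvgrPdist_lt fl e /fl[r /= r0 H]|H].
  by exists r => // z zx Dz zr; apply: (H z) => //=; rewrite distrC.
apply/cvgrPdist_lt => e /H[r r0 Hr]; exists r => //= z zr zx Dz.
by apply: Hr => //; rewrite distrC.
Qed.

Lemma is_derive1P f x l : is_derive x 1 f l <-> is_derive_within setT f x l.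
Proof.
split=> [/is_derive1_caratheodory[g [fE gc gx]]|/is_derive_withinP fl].
  apply/is_derive_withinP => e e0.
  have /cvgrPdist_lt/(_ e e0)[r /= r0 H] := gc.
  exists r => // z zx _ zr; rewrite fE mulfK ?subr_eq0// -gx.
  by apply: H; rewrite /= distrC.
apply/is_derive1_caratheodory.
exists (fun z => if z == x then l else (f z - f x) / (z - x)); split.
- move=> z; case: eqVneq => [->|zx]; first by rewrite !subrr mulr0.
  by rewrite divfK// subr_eq0.
- apply/cvgrPdist_lt => e e0; have [r r0 H] := fl e e0.
  exists r => //= z /=; rewrite eqxx (distrC x) => zr.
  by case: eqVneq => [_|zx]; [rewrite subrr normr0 | exact: (H z zx)].
- by rewrite eqxx.
Qed.

Lemma is_derive_withinW D f x l : is_derive x 1 f l -> is_derive_within D f x l.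
Proof.
move=> /is_derive1P/is_derive_withinP fl; apply/is_derive_withinP => e /fl[r r0 H].
by exists r => // z zx _ zr; exact: (H z zx I zr).
Qed.

Lemma is_derive_within_interior a b f x l : a < x < b ->
  is_derive_within `[a, b] f x l -> is_derive x 1 f l.
Proof.
move=> /andP[ax xb] /is_derive_withinP fl;
  apply/is_derive1P/is_derive_withinP => e /fl[r r0 H].
pose r' := Num.min r (Num.min (x - a) (b - x)).
exists r' => [|z zx _]; first by rewrite !lt_min r0 !subr_gt0 ax.
rewrite !lt_min => /and3P[zr /ltr_normlP[h1 h2] /ltr_normlP[h3 h4]].
by apply: H => //=; rewrite in_itv/=; apply/andP; split; lra.
Qed.

End one_sided.

(** * Eigenfunctions *)

Section regularization.
Context {R : realType}.
Implicit Types (Q q y dy : R -> R) (m x T c : R).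
Local Notation mu := (@lebesgue_measure R).

Lemma regular_solution_continuous Q T m y u x : regular_solution Q T m y u ->
  0 <= x <= T -> {for x, continuous y} /\ {for x, continuous u}.
Proof. by move=> s /s[/deriv_cont yc /deriv_cont uc]. Qed.

Lemma regular_solution_abs_continuous Q T m y u : continuous Q ->
  regular_solution Q T m y u -> abs_continuous 0 T y /\ abs_continuous 0 T u.
Proof.
move=> Qc s; have sc x := regular_solution_continuous _ _ _ _ _ x s.
split.
  apply: (deriv_abs_continuous _ (fun x => Q x * y x + u x)) => x xT.
    by have [] := s x xT.
  have [yc uc] := sc x xT.
  by apply: (@continuousD R R R) => //; apply: (@continuousM R R) => //; exact: Qc.
apply: (deriv_abs_continuous _ (fun x => - (m + Q x ^+ 2) * y x - Q x * u x))
  => x xT.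
  by have [] := s x xT.
have [yc uc] := sc x xT; have Qx := Qc x.
apply: (@continuousB R R R); apply: (@continuousM R R) => //.
apply: (@continuousN R R R); apply: (@continuousD R R R);
  first exact: cst_continuous.
exact: (@continuousM R R).
Qed.

(** The matrix of the system has trace [Q - Q = 0], so the Wronskian is constant. *)
Lemma regular_wronskian Q T m y u z w : regular_solution Q T m y u ->
  regular_solution Q T m z w -> forall x, 0 <= x <= T ->
  y x * w x - u x * z x = y 0 * w 0 - u 0 * z 0.
Proof.
move=> s1 s2 x /andP[x0 xT].
have W z' : 0 <= z' <= x -> is_derive z' 1 (fun x => y x * w x - u x * z x) 0.
  move=> /andP[z0 zx]; have zT : 0 <= z' <= T by rewrite z0 (le_trans zx).
  have [yd ud] := s1 z' zT; have [zd wd] := s2 z' zT.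
  apply: is_derive_eq (derivB _ _ _ _ _ (derivM _ _ _ _ _ yd wd) (derivM _ _ _
    _ _ ud zd)) _.
  by ring.
by have [c _ /eqP] := MVT_closed (fun=> 0) W x0; rewrite mul0r subr_eq0 => /eqP.
Qed.

(** Real form of [SL_solution], satisfied by the real and the imaginary part when the parameter is
    real. *)
Definition real_solution q m y dy :=
  [/\ abs_continuous 0 pi y, abs_continuous 0 pi dy,
      forall x : R, x \in `[0, pi] -> is_derive_within `[0, pi] y x (dy x) &
      {ae mu, forall x : R, x \in `]0, pi[ ->
        exists2 ddy : R, is_derive_within `[0, pi] dy x ddy &
          - ddy + q x * y x = m * y x}].

(** Here [dy - Q y] is the quasi-derivative of [y]. It is only absolutely continuous, so the
    Wronskian has zero derivative almost everywhere and [abs_continuous_deriv0] concludes. *)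
Lemma real_solution_wronskian Q q m y dy z w : continuous Q ->
  abs_continuous 0 pi Q -> {ae mu, forall x : R, x \in `]0, pi[ ->
    is_derive x 1 Q (q x)} ->
  real_solution q m y dy -> regular_solution Q pi m z w ->
  forall x, 0 <= x <= pi ->
  y x * w x - (dy x - Q x * y x) * z x = y 0 * w 0 - (dy 0 - Q 0 * y 0) * z 0.
Proof.
move=> Qc Qac Qq [yac dyac yd ydd] s x /andP[x0 xpi].
have [zac wac] := regular_solution_abs_continuous _ _ _ _ _ Qc s.
pose V x := y x * w x + ((-1) * (dy x * z x) + Q x * (y x * z x)).
have VE x' : y x' * w x' - (dy x' - Q x' * y x') * z x' = V x' by rewrite /V; ring.
rewrite !VE; apply: abs_continuous_deriv0 => //.
  apply: abs_continuousS xpi _; have p0 := pi_ge0 R.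
  apply: abs_continuousD; first exact: abs_continuousM.
  apply: abs_continuousD; apply: abs_continuousM => //; try exact: abs_continuousM.
  exact: abs_continuous_cst.
apply: filterS2 Qq ydd; first exact: (ae_filter_ringOfSetsType mu).
move=> t Qt ydt; rewrite in_itv/= => /andP[t0 tx].
have tpi : 0 < t < pi by rewrite t0 (lt_le_trans tx).
have tpi' : t \in `]0, pi[ by rewrite in_itv.
have tpi2 : 0 <= t <= pi by case/andP: tpi => ? ?; rewrite !ltW.
have {}Qt := Qt tpi'; have [ddy dyd eqn] := ydt tpi'.
have {}dyd := is_derive_within_interior _ _ _ _ _ tpi dyd.
have ytd : is_derive t 1 y (dy t).
  by apply: is_derive_within_interior tpi _; apply: yd; rewrite in_itv.
have [zd wd] := s t tpi2.
apply: is_derive_eq (derivD _ _ _ _ _ (derivM _ _ _ _ _ ytd wd)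
  (derivD _ _ _ _ _ (derivM _ _ _ _ _ (deriv_cst _ _) (derivM _ _ _ _ _ dyd zd))
    (derivM _ _ _ _ _ Qt (derivM _ _ _ _ _ ytd zd)))) _.
have -> : ddy = q t * y t - m * y t by rewrite -eqn; ring.
by ring.
Qed.

(** The boundary condition at 0 makes the Wronskian of [y] with the Pruefer solution vanish. A
    second solution, whose angle starts [pi / 2] further, has Wronskian -1 with the first; solving
    both relations for [y] and its quasi-derivative gives the multiple. *)
Lemma real_solution_prufer Q q m th r alpha y dy : continuous Q -> Q 0 = 0 ->
  abs_continuous 0 pi Q -> {ae mu, forall x : R, x \in `]0, pi[ ->
    is_derive x 1 Q (q x)} ->
  real_solution q m y dy -> y 0 * cos alpha + dy 0 * sin alpha = 0 ->
  th 0 = pi - alpha -> r 0 = 1 ->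
  regular_solution Q pi m (fun x => r x * sin (th x)) (fun x => r x * cos (th x)) ->
  exists c : R, forall x, 0 <= x <= pi -> y x = c * (r x * sin (th x)) /\
    dy x = c * (Q x * (r x * sin (th x)) + r x * cos (th x)).
Proof.
move=> Qc Q0 Qac Qq ys bc th0 r0 s; have p0 := pi_ge0 R.
have [th2 th20 th2d] := prufer_angle_exists Q pi m (th 0 + pi / 2) p0 Qc.
have [r2 [r20 _ s2]] := regular_solution_exists Q pi m th2 Qc p0 th2d.
have W1 := real_solution_wronskian _ _ _ _ _ _ _ Qc Qac Qq ys s.
have W2 := real_solution_wronskian _ _ _ _ _ _ _ Qc Qac Qq ys s2.
have D := regular_wronskian _ _ _ _ _ _ _ s s2.
pose c0 := y 0 * (r2 0 * cos (th2 0)) - (dy 0 - Q 0 * y 0) * (r2 0 * sin (th2 0)).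
exists (- c0) => x xpi.
have {W1} := W1 x xpi; have {W2} := W2 x xpi; rewrite -/c0; have {D} := D x xpi.
rewrite r0 r20 !mul1r th20 cosDpihalf sinDpihalf Q0 mul0r subr0.
have -> : y 0 * cos (th 0) - dy 0 * sin (th 0) = 0.
  by rewrite th0 cosB sinB cospi sinpi; lra.
have -> : sin (th 0) * - sin (th 0) - cos (th 0) * cos (th 0) = -1.
  by rewrite -(cos2Dsin2 (th 0)); ring.
set p1 := r x * sin _; set p2 := r x * cos _; set q1 := r2 x * sin _;
  set q2 := r2 x * cos _.
move=> D W2 /eqP; rewrite subr_eq0 => /eqP W1.
have yE : y x = - c0 * p1.
  transitivity (- (y x * (p1 * q2 - p2 * q1))); first by rewrite D; ring.
  rewrite -W2 mulrBr (_ : y x * (p2 * q1) = (y x * p2) * q1); last by ring.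
  by rewrite W1; ring.
have uE : dy x - Q x * y x = - c0 * p2.
  transitivity (- ((dy x - Q x * y x) * (p1 * q2 - p2 * q1)));
    first by rewrite D; ring.
  rewrite -W2 mulrBr (_ : _ * (p1 * q2) = ((dy x - Q x * y x) * p1) * q2);
    last by ring.
  by rewrite -W1; ring.
split=> //; have -> : dy x = (dy x - Q x * y x) + Q x * y x by ring.
by rewrite uE yE; ring.
Qed.

End regularization.

(** * Complex eigenfunctions in Pruefer form *)

Section eigenfunctions.
Context {R : realType}.
Implicit Types (Q q : R -> R) (m x T c : R) (z : R[i]).
Local Notation mu := (@lebesgue_measure R).

Lemma ReMr z x : complex.Re (z * x%:C) = complex.Re z * x.
Proof. by case: z => a b; rewrite /= mulr0 subr0. Qed.

Lemma ImMr z x : complex.Im (z * x%:C) = complex.Im z * x.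
Proof. by case: z => a b; rewrite /= mulr0 add0r. Qed.

Lemma ReD (z w : R[i]) : complex.Re (z + w) = complex.Re z + complex.Re w.
Proof. by case: z w => [? ?] []. Qed.

Lemma ImD (z w : R[i]) : complex.Im (z + w) = complex.Im z + complex.Im w.
Proof. by case: z w => [? ?] []. Qed.

Lemma ReN z : complex.Re (- z) = - complex.Re z.
Proof. by case: z. Qed.

Lemma ImN z : complex.Im (- z) = - complex.Im z.
Proof. by case: z. Qed.

Lemma complexP (z w : R[i]) :
  complex.Re z = complex.Re w -> complex.Im z = complex.Im w -> z = w.
Proof. by case: z w => [? ?] [? ?] /= -> ->. Qed.

Definition cE := (ReMr, ImMr, ReD, ImD, ReN, ImN).

Lemma SL_solution_components q m (y dy : R -> R[i]) : SL_solution q m%:C y dy ->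
  real_solution q m (fun x => complex.Re (y x)) (fun x => complex.Re (dy x)) /\
  real_solution q m (fun x => complex.Im (y x)) (fun x => complex.Im (dy x)).
Proof.
move=> [[yr yi] [dyr dyi] yd ydd]; split; split => //.
- by move=> x /yd[].
- apply: filterS ydd; first exact: (ae_filter_ringOfSetsType mu).
  move=> x H /H[ddy [dr _] /(congr1 (@complex.Re R))].
  by rewrite -(mulrC (y x)) -(mulrC (y x)) !cE => e;
    exists (complex.Re ddy) => //=; rewrite mulrC e mulrC.
- by move=> x /yd[].
- apply: filterS ydd; first exact: (ae_filter_ringOfSetsType mu).
  move=> x H /H[ddy [_ di] /(congr1 (@complex.Im R))].
  by rewrite -(mulrC (y x)) -(mulrC (y x)) !cE => e;
    exists (complex.Im ddy) => //=; rewrite mulrC e mulrC.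
Qed.

(** Real and imaginary parts obey the same real boundary condition at 0, so they are real multiples
    [a] and [b] of the Pruefer solution, and [c = a +i* b]. The last clause is the boundary
    condition at [pi] divided by [c]. *)
Lemma SL_eigenfunction_prufer Q q m th r alpha beta (y : R -> R[i]) :
  continuous Q -> Q 0 = 0 ->
  abs_continuous 0 pi Q -> {ae mu, forall x : R, x \in `]0, pi[ ->
    is_derive x 1 Q (q x)} ->
  SL_eigenfunction q alpha beta m%:C y ->
  th 0 = pi - alpha -> r 0 = 1 ->
  regular_solution Q pi m (fun x => r x * sin (th x)) (fun x => r x * cos (th x)) ->
  exists2 c : R[i], c != 0 &
    [/\ forall x, 0 <= x <= pi -> y x = c * (r x * sin (th x))%:C,
      forall x, 0 <= x <= pi -> is_cderive_within `[0, pi] y x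
        (c * (Q x * (r x * sin (th x)) + r x * cos (th x))%:C) &
      r pi * (sin (th pi) * (cos beta + Q pi * sin beta) + cos (th pi) * sin
        beta) = 0].
Proof.
move=> Qc Q0 Qac Qq [dy [sol [x0 x0pi yx0] bc0 bcpi]] th0 r0 s.
have pi0 : 0 <= (pi : R) <= pi by rewrite pi_ge0 lexx.
have [sr si] := SL_solution_components _ _ _ _ sol.
have br := congr1 (@complex.Re R) bc0; have bi := congr1 (@complex.Im R) bc0.
rewrite !cE in br bi.
have [a Ha] := real_solution_prufer _ _ _ _ _ _ _ _ Qc Q0 Qac Qq sr br th0 r0 s.
have [b Hb] := real_solution_prufer _ _ _ _ _ _ _ _ Qc Q0 Qac Qq si bi th0 r0 s.
have yE x : 0 <= x <= pi -> y x = (a +i* b) * (r x * sin (th x))%:C.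
  move=> xpi; have [ha _] := Ha x xpi; have [hb _] := Hb x xpi.
  by apply: complexP; rewrite cE; [exact: ha | exact: hb].
have dyE x : 0 <= x <= pi -> dy x = (a +i* b) * (Q x * (r x * sin (th x)) + r x
  * cos (th x))%:C.
  move=> xpi; have [_ ha] := Ha x xpi; have [_ hb] := Hb x xpi.
  by apply: complexP; rewrite cE; [exact: ha | exact: hb].
have c0 : a +i* b != 0.
  apply: contra_neq yx0 => c0; rewrite yE ?c0 ?mul0r//.
exists (a +i* b) => //; split => //.
- by move=> x xpi; rewrite -dyE//; case: sol => _ _ H _; apply: H; rewrite in_itv.
- move: bcpi; rewrite yE// dyE// -!mulrA -mulrDr => /eqP;
    rewrite mulf_eq0 (negPf c0)/=.
  move=> /eqP/(congr1 (@complex.Re R)); rewrite !cE/= => <-; ring.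
Qed.

Lemma prufer_SL_eigenvalue Q q m th r alpha beta : continuous Q -> Q 0 = 0 ->
  abs_continuous 0 pi Q -> {ae mu, forall x : R, x \in `]0, pi[ ->
    is_derive x 1 Q (q x)} ->
  th 0 = pi - alpha -> r 0 = 1 -> (forall x, 0 < r x) ->
  regular_solution Q pi m (fun x => r x * sin (th x)) (fun x => r x * cos (th x)) ->
  sin (th pi) * (cos beta + Q pi * sin beta) + cos (th pi) * sin beta = 0 ->
  SL_eigenvalue q alpha beta m%:C.
Proof.
move=> Qc Q0 Qac Qq th0 r0 rp s bc; have p0 := pi_ge0 R.
set p1 := (X in regular_solution _ _ _ X _) in s.
set p2 := (X in regular_solution _ _ _ _ X) in s.
have [ac1 ac2] := regular_solution_abs_continuous _ _ _ _ _ Qc s.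
pose dp x := Q x * p1 x + p2 x.
have ac3 : abs_continuous 0 pi dp by apply: abs_continuousD => //;
  exact: abs_continuousM.
have cst0 (D : set R) x : is_derive_within D (fun=> 0) x 0.
  by apply: is_derive_withinW; exact: deriv_cst.
have p10 : p1 0 = sin alpha by rewrite /p1 r0 th0 sinB sinpi cospi; ring.
have p20 : p2 0 = - cos alpha by rewrite /p2 r0 th0 cosB sinpi cospi; ring.
exists (fun x => (p1 x)%:C), (fun x => (dp x)%:C); split.
- split.
  + by split => //; exact: abs_continuous_cst.
  + by split => //; exact: abs_continuous_cst.
  + move=> x; rewrite in_itv => xpi; split => //=.
    by apply: is_derive_withinW; have [] := s x xpi.
  + apply: filterS Qq; first exact: (ae_filter_ringOfSetsType mu).
    move=> x Qx xpi.
    (* In the derivative of [Q p1 + p2] the terms containing [Q] cancel. *)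
    exists (q x * p1 x - m * p1 x)%:C.
      split => //=; apply: is_derive_withinW.
      have [|p1d p2d] := s x; first by move: xpi;
        rewrite in_itv/= => /andP[? ?]; rewrite !ltW.
      apply: is_derive_eq (derivD _ _ _ _ _ (derivM _ _ _ _ _ (Qx xpi) p1d) p2d) _.
      by ring.
    by apply: complexP; rewrite /=; ring.
(* If [p1] vanished identically, so would its derivative [Q p1 + p2]; then sine and cosine of the
   angle would both be 0 at the midpoint. *)
- apply: contrapT => nex.
  have z0 x : 0 <= x <= pi -> p1 x = 0.
    move=> xpi; apply: contrapT => /eqP px; apply: nex; exists x;
      first by rewrite in_itv.
    by apply: contra_neq px => /(congr1 (@complex.Re R)).
  have hp : 0 < (pi : R) / 2 < pi by have := pi_gt0 R; move=> ?; apply/andP;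
    split; lra.
  have hp' : 0 <= (pi : R) / 2 <= pi by case/andP: hp => ? ?; rewrite !ltW.
  have [p1d _] := s _ hp'.
  have := deriv_locally_cst p1 0 pi 0 _ _ hp _ p1d.
  rewrite z0// mulr0 add0r => p2z.
  have : p2 (pi / 2) = 0 by apply: p2z => t /andP[t0 tpi]; rewrite z0// !ltW.
  have := z0 _ hp'; rewrite /p1 /p2 => /eqP + /eqP.
  rewrite !mulf_eq0 gt_eqF//= => /eqP st /eqP ct.
  by have := cos2Dsin2 (th (pi / 2)); rewrite st ct expr0n addr0 => /eqP;
    rewrite eq_sym oner_eq0.
- by apply: complexP; rewrite !cE/= /dp ?Q0 ?p10 ?p20; ring.
- apply: complexP; rewrite !cE/= /dp; last by ring.
  have -> : p1 pi * cos beta + (Q pi * p1 pi + p2 pi) * sin beta =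
    r pi * (sin (th pi) * (cos beta + Q pi * sin beta) + cos (th pi) * sin beta).
    by rewrite /p1 /p2; ring.
  by rewrite bc mulr0.
Qed.

End eigenfunctions.

(** Polar form of the boundary vector, with [p] the value of [Q] at [pi] that passes from y' to the
    quasi-derivative. The boundary condition at [pi] then reads [sin (th pi - tb) = 0], and
    [tb = pi] is the Dirichlet case. *)
Lemma boundary_angle (R : realType) (p beta : R) : 0 <= beta < pi ->
  exists tb rho : R, [/\ 0 < tb <= pi, 0 < rho,
    (tb == pi) = (beta == 0),
    cos beta + p * sin beta = - (rho * cos tb) & sin beta = rho * sin tb].
Proof.
move=> /andP[b0 bpi]; have p0 := pi_gt0 R.
have [->|bn0] := eqVneq beta 0.
  by exists pi, 1; rewrite p0 lexx eqxx sinpi cospi cos0 sin0; split => //; ring.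
have S0 : 0 < sin beta by apply: sin_gt0_pi; rewrite lt_neqAle eq_sym bn0 b0.
set S := sin beta in S0 *; set C := cos beta + _.
pose a := atan (C / S).
have a1 := atan_gtNpi2 (C / S); have a2 := atan_ltpi2 (C / S); rewrite -/a in a1 a2.
have ca : 0 < cos a by apply: cos_gt0_pihalf; rewrite a1.
have sa : sin a = C / S * cos a by rewrite -(atanK (C / S)) -/a /tan divfK// gt_eqF.
exists (a + pi / 2), (S / cos a); split.
- by apply/andP; split; lra.
- by rewrite divr_gt0.
- by apply/negP => /eqP h; lra.
- by rewrite cosDpihalf mulrN opprK sa; field; rewrite !gt_eqF.
- by rewrite sinDpihalf divfK// gt_eqF.
Qed.

(** Strict increase gives [n <= K n]. If the inequality were strict, [n] would be some [K m] with
    [m <= n]; the case [m = n] is absurd, and for [m < n] induction gives [K m = m]. *)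
Lemma homo_downclosed_id (K : nat -> nat) : {homo K : m n / (m < n)%N} ->
  (forall n j, (j < K n)%N -> exists m, K m = j) -> K =1 id.
Proof.
move=> Kinc Kdown.
have Kge n : (n <= K n)%N.
  by elim: n => // n IH; apply: leq_ltn_trans IH (Kinc _ _ (ltnSn n)).
elim/ltn_ind => n IH; apply/eqP; rewrite eqn_leq Kge andbT leqNgt; apply/negP => nK.
have [m Km] := Kdown n n nK.
have : (m <= n)%N by rewrite -[leqRHS]Km.
rewrite leq_eqVlt => /predU1P[mn|mn]; first by rewrite mn in Km;
  rewrite Km ltnn in nK.
by have := IH m mn; rewrite Km => nm; rewrite nm ltnn in mn.
Qed.

(** * Numbering of the eigenvalues and number of zeros *)

Theorem theorem1 (R : realType) (q : R -> R) (alpha beta : R)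
    (mu : nat -> R)
    (hq : in_L1 `[0, pi] q)
    (halpha : 0 < alpha <= pi) (hbeta : 0 <= beta < pi)
    (mu_increasing : forall m n : nat, (m < n)%N -> mu m < mu n)
    (mu_enumerates : forall z : R[i],
       SL_eigenvalue q alpha beta z <-> exists n : nat, z = (mu n)%:C)
    (n : nat) (y : R -> R[i])
    (hy : SL_eigenfunction q alpha beta (mu n)%:C y) :
  [/\ zeros_in `]0, pi[ y #= `I_n,
      forall x, zeros_in `]0, pi[ y x -> simple_zero y x,
      (alpha = pi /\ beta = 0 -> zeros_in `[0, pi] y #= `I_n.+2) &
      (alpha = pi /\ 0 < beta < pi) \/ (beta = 0 /\ 0 < alpha < pi) ->
        zeros_in `[0, pi] y #= `I_n.+1].
Proof.
have p0 := pi_gt0 R; have p0' := ltW p0.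
have [Q [Qc Q0 Qac Qq]] := L1_primitive_exists pi q p0 hq.
have [tb [rho [/andP[tb0 tbpi] rho0 tbE bC bS]]] := boundary_angle _ (Q pi) _ hbeta.
(* This angle has sine [sin alpha] and cosine [- cos alpha], which meets the boundary condition at
   0; it is 0 exactly when [alpha = pi]. *)
pose t0 := pi - alpha.
have t00 : 0 <= t0 by rewrite subr_ge0; case/andP: halpha.
have t0pi : t0 < pi by rewrite /t0; case/andP: halpha; lra.
have /choice[th Hth] : forall m,
    exists th : R -> R, th 0 = t0 /\ prufer_angle Q pi m th.
  by move=> m; have [th th0 thd] := prufer_angle_exists Q pi m t0 p0' Qc; exists th.
have th0 m : th m 0 = t0 by case: (Hth m).
have thd m : prufer_angle Q pi m (th m) by case: (Hth m).
have bcE x : sin x * (cos beta + Q pi * sin beta) + cos x * sin beta =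
    - rho * sin (x - tb).
  by rewrite bC bS sinB; ring.
have th_gt0 m : 0 < th m pi.
  by apply: (prufer_angle_level Q pi m _ 0 0) => //; rewrite ?sin0 ?th0.
have eig_level m z : SL_eigenfunction q alpha beta m%:C z ->
    exists k : nat, th m pi = tb + k%:R * pi.
  move=> hz; have [r [r0 rp s]] := regular_solution_exists Q pi m _ Qc p0' (thd m).
  have [c _ [_ _ /eqP]] := SL_eigenfunction_prufer _ _ _ _ _ _ _ _ Qc Q0 Qac Qq
    hz (th0 m) r0 s.
  rewrite bcE mulf_eq0 gt_eqF//= mulf_eq0 oppr_eq0 gt_eqF//= => /eqP s0.
  (* As [th m pi > 0] and [tb <= pi], adding [pi] makes the argument positive; its index is thus at
     least 1, and the level at least 0. *)
  have [||k hk] := sin_eq0_natpi (th m pi - tb + pi).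
  - by have := th_gt0 m; lra.
  - by rewrite sinDpi s0 oppr0.
  case: k hk => [|k]; first by rewrite mul0r; have := th_gt0 m; lra.
  by rewrite -natr1 mulrDl mul1r => hk; exists k; lra.
have level_eig m (k : nat) : th m pi = tb + k%:R * pi ->
  SL_eigenvalue q alpha beta m%:C.
  move=> hk; have [r [r0 rp s]] := regular_solution_exists Q pi m _ Qc p0' (thd m).
  apply: (prufer_SL_eigenvalue _ _ _ _ _ _ _ Qc Q0 Qac Qq (th0 m) r0 rp s).
  by rewrite bcE hk addrC addKr sin_natpi mulr0.
have /choice[K HK] : forall n, exists k : nat, th (mu n) pi = tb + k%:R * pi.
  by move=> j; have [z /eig_level] := (mu_enumerates (mu j)%:C).2 (ex_intro _ j
    erefl).
have Kid : K =1 id.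
  apply: homo_downclosed_id => [i j ij|i j ji].
    have := prufer_angle_lt Q pi _ _ _ _ Qc p0 (mu_increasing i j ij) (thd _)
      (thd _)
      (etrans (th0 _) (esym (th0 _))).
    by rewrite !HK ltrD2l ltr_pM2r// ltr_nat.
  (* To reach a lower level [j]: at [m0] the final angle is at most [tb / 2], below [tb + j * pi],
     and at [mu i] it is above. An intermediate parameter attains the level, so it is an eigenvalue
     and occurs in the enumeration. *)
  have tb2 : 0 < tb / 2 by rewrite divr_gt0.
  have [m0 Hm0] := prufer_angle_small Q pi t0 (tb / 2) Qc p0 t0pi tb2.
  have {}Hm0 := Hm0 _ (thd m0) (th0 m0).
  have jpi : 0 <= j%:R * pi :> R by rewrite mulr_ge0.
  have jK : tb + j%:R * pi <= th (mu i) pi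
    by rewrite HK lerD2l ler_pM2r// ler_nat ltnW.
  have m0i : m0 <= mu i.
    rewrite leNgt; apply/negP => /ltW im.
    have := prufer_angle_le Q pi _ _ _ _ Qc im (thd _) (thd _)
      (etrans (th0 _) (esym (th0 _))) pi; rewrite p0' lexx => /(_ isT); lra.
  have thc := prufer_angle_param_continuous Q pi t0 th Qc p0' thd th0.
  have [|m _ hm] := @IVT R _ _ _ (tb + j%:R * pi) m0i (continuous_subspaceT thc).
    by rewrite ge_min le_max jK orbT andbT; apply/orP; left; lra.
  have /mu_enumerates[k [mk]] := level_eig m j hm.
  exists k; have := HK k; rewrite -mk hm => /addrI/(mulIf (lt0r_neq0 p0))/eqP.
  by rewrite eqr_nat => /eqP.
have thn : th (mu n) pi = tb + n%:R * pi by rewrite HK Kid.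
have [r [r0 rp s]] := regular_solution_exists Q pi (mu n) _ Qc p0' (thd (mu n)).
have [c c0 [yE yd _]] := SL_eigenfunction_prufer _ _ _ _ _ _ _ _ Qc Q0 Qac Qq
  hy (th0 _) r0 s.
have y0E x : 0 <= x <= pi -> y x = 0 <-> sin (th (mu n) x) = 0.
  move=> xpi; rewrite yE//; split => [/eqP|->]; last by rewrite mulr0 mulr0.
  rewrite mulf_eq0 (negPf c0)/= => /eqP/(congr1 (@complex.Re R))/= /eqP.
  by rewrite mulf_eq0 gt_eqF// => /eqP.
have zo : zeros_in `]0, pi[ y = [set x | 0 < x < pi /\ sin (th (mu n) x) = 0].
  apply/seteqP; split => x [/=]; rewrite ?in_itv/= => /[dup] xpi /andP[/ltW x0
    /ltW xp] h;
    split=> //=; rewrite ?in_itv//; apply/y0E => //; by rewrite x0.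
have zc : zeros_in `[0, pi] y = [set x | 0 <= x <= pi /\ sin (th (mu n) x) = 0].
  by apply/seteqP; split => x [/=]; rewrite ?in_itv/= => xpi h;
    split=> //=; rewrite ?in_itv//; apply/y0E.
have closed := prufer_zeros_closed Q pi (mu n) (th (mu n)) _ _ Qc p0' (thd _) _ _.
rewrite th0 thn in closed.
(* The final angle is [tb + n * pi]: the highest level met is [n + 1] when [tb = pi], that is
   [beta = 0], and [n] otherwise. *)
have up1 (j : nat) : beta = 0 -> (j%:R * pi <= tb + n%:R * pi) = (j < n.+2)%N.
  move=> /eqP; rewrite -tbE => /eqP ->.
  by rewrite -[X in X + _]mul1r -mulrDl nat1r ler_pM2r// ler_nat.
have up0 (j : nat) : tb < pi -> (j%:R * pi <= tb + n%:R * pi) = (j < n.+1)%N.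
  move=> tbp; rewrite ltnS; have [jn|nj] := leqP j n.
    by have : j%:R * pi <= n%:R * pi :> R; [rewrite ler_pM2r// ler_nat | lra].
  apply/negbTE; rewrite -ltNge.
  have : n.+1%:R * pi <= j%:R * pi :> R by rewrite ler_pM2r// ler_nat.
  by rewrite -natr1 mulrDl mul1r; lra.
have low (j : nat) : 0 < t0 -> (t0 <= j%:R * pi) = (0 < j)%N.
  case: j => [|j] t0p; first by rewrite mul0r leNgt t0p.
  by apply: le_trans (ltW t0pi) _; rewrite ler_peMl// ler1n.
split.
- rewrite zo; apply: (prufer_zeros_open Q pi (mu n)) => //;
    first by rewrite th0 t00.
  by rewrite thn -natr1 mulrDl mul1r; apply/andP; split; lra.
- move=> x; rewrite zo => -[/andP[/ltW x0 /ltW xp] sx].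
  have xpi : 0 <= x <= pi by rewrite x0.
  split; first exact/y0E.
  eexists; first exact: yd.
  (* At a zero the derivative is [c * r x * cos (th (mu n) x)], where the cosine has square 1. *)
  rewrite mulf_neq0// sx mulr0 mulr0 add0r;
    apply/eqP => /(congr1 (@complex.Re R))/= /eqP.
  rewrite mulf_eq0 gt_eqF//= => /eqP cx.
  by have := sin0_cos2 _ sx; rewrite cx expr0n => /eqP; rewrite eq_sym oner_eq0.
(* Both endpoints are zeros: the levels met are 0 to [n + 1]. *)
- move=> [aE bE]; rewrite zc; apply: (closed 0%N) => // j.
  by rewrite up1 -?bE// /t0 aE subrr mulr_ge0 ?ler0n.
(* One endpoint is a zero: the levels are 0 to [n] when [alpha = pi], and 1 to [n + 1] when
   [beta = 0]. *)
- rewrite zc => -[[aE /andP[b0 _]]|[bE /andP[a0 api]]].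
    apply: (closed 0%N) => // j; rewrite up0.
      by rewrite /t0 aE subrr mulr_ge0 ?ler0n.
    by rewrite lt_neqAle tbpi tbE gt_eqF.
  apply: (closed 1%N) => // j; rewrite up1//.
  by congr (_ && _); rewrite low// subr_gt0.
Qed.
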